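(* Let $X$ be a real convex-transitive Banach space satisfying the following two conditions: (a) the set of $\omega$-exposed points of $B_X$ is dense in $S_X$ with respect to the relative weak topology of $S_X$; (b) $\inf\{\operatorname{diam}(U) : U\subset S_X \text{ nonempty and relatively weakly open in } S_X\}<2$. Then $X\in\mathcal{J}$, i.e. $X$ is almost transitive, uniformly convex and uniformly smooth.
   Context: All spaces are real Banach spaces. $B_X$ is the closed unit ball and $S_X$ the unit sphere of $X$. $\mathcal{G}_X$ denotes the group of isometric automorphisms (surjective linear isometries) of $X$, and for $x\in S_X$ the orbit is $\mathcal{G}_X(x)=\{T(x): T\in\mathcal{G}_X\}$. $X$ is almost transitive if $\overline{\mathcal{G}_X(x)}=S_X$ for all $x\in S_X$, and convex-transitive if $\overline{\mathrm{conv}}(\mathcal{G}_X(x))=B_X$ for all $x\in S_X$. $\mathcal{J}$ denotes the class of Banach spaces that are simultaneously almost transitive, uniformly convex and uniformly smooth. A point $x\in S_X$ is $\omega$-exposed (weakly exposed) if there is $f\in S_{X^*}$ with $f(x)=1$ such that every sequence $(x_n)\subset B_X$ with $f(x_n)\to 1$ converges weakly to $x$. *)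

(* Defs.v *)
From Stdlib Require Import Reals Lra List.
Open Scope R_scope.

Record Banach := {
  car :> Type;
  vadd : car -> car -> car;
  vzero : car;
  vopp : car -> car;
  vscal : R -> car -> car;
  vnorm : car -> R;
  vadd_assoc : forall x y z, vadd x (vadd y z) = vadd (vadd x y) z;
  vadd_comm : forall x y, vadd x y = vadd y x;
  vadd_0 : forall x, vadd vzero x = x;
  vadd_opp : forall x, vadd (vopp x) x = vzero;
  vscal_addr : forall a x y, vscal a (vadd x y) = vadd (vscal a x) (vscal a y);
  vscal_addl : forall a b x, vscal (a + b) x = vadd (vscal a x) (vscal b x);
  vscal_assoc : forall a b x, vscal a (vscal b x) = vscal (a * b) x;
  vscal_1 : forall x, vscal 1 x = x;
  vnorm_eq0 : forall x, vnorm x = 0 -> x = vzero;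
  vnorm_scal : forall a x, vnorm (vscal a x) = Rabs a * vnorm x;
  vnorm_triangle : forall x y, vnorm (vadd x y) <= vnorm x + vnorm y;
  complete : forall u : nat -> car,
    (forall eps, eps > 0 -> exists N, forall n m, (n >= N)%nat -> (m >= N)%nat ->
        vnorm (vadd (u n) (vopp (u m))) < eps) ->
    exists l, forall eps, eps > 0 -> exists N, forall n, (n >= N)%nat ->
        vnorm (vadd (u n) (vopp l)) < eps
}.

Arguments vadd {_}. Arguments vzero {_}. Arguments vopp {_}.
Arguments vscal {_}. Arguments vnorm {_}.

Section Defs.
Variable X : Banach.

Definition vsub (x y : X) : X := vadd x (vopp y).

Definition ball (x : X) : Prop := vnorm x <= 1.
Definition sphere (x : X) : Prop := vnorm x = 1.

Definition dual_elt (f : X -> R) : Prop :=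
  (forall x y, f (vadd x y) = f x + f y) /\
  (forall a x, f (vscal a x) = a * f x) /\
  (exists C, forall x, Rabs (f x) <= C * vnorm x).

Definition dual_norm_is (f : X -> R) (r : R) : Prop :=
  is_lub (fun s => exists x, ball x /\ s = Rabs (f x)) r.

Definition dual_sphere (f : X -> R) : Prop := dual_elt f /\ dual_norm_is f 1.

Definition weak_cv (u : nat -> X) (x : X) : Prop :=
  forall g, dual_elt g -> Un_cv (fun n => g (u n)) (g x).

Definition w_exposed (x : X) : Prop :=
  sphere x /\
  exists f, dual_sphere f /\ f x = 1 /\
    forall u : nat -> X, (forall n, ball (u n)) ->
      Un_cv (fun n => f (u n)) 1 -> weak_cv u x.

Definition rel_weak_open_S (U : X -> Prop) : Prop :=
  (forall x, U x -> sphere x) /\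
  forall x, U x -> exists (fs : list (X -> R)) (eps : R),
    Forall dual_elt fs /\ eps > 0 /\
    forall y, sphere y -> Forall (fun f => Rabs (f y - f x) < eps) fs -> U y.

Definition weakly_dense_in_S (A : X -> Prop) : Prop :=
  forall U, rel_weak_open_S U -> (exists x, U x) -> exists x, U x /\ A x.

Definition diam_is (U : X -> Prop) (d : R) : Prop :=
  is_lub (fun s => exists x y, U x /\ U y /\ s = vnorm (vsub x y)) d.

Definition isom_aut (T : X -> X) : Prop :=
  (forall x y, T (vadd x y) = vadd (T x) (T y)) /\
  (forall a x, T (vscal a x) = vscal a (T x)) /\
  (forall x, vnorm (T x) = vnorm x) /\
  (forall y, exists x, T x = y).

Definition orbit (x : X) (y : X) : Prop := exists T, isom_aut T /\ y = T x.

Definition closure (A : X -> Prop) (y : X) : Prop :=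
  forall eps, eps > 0 -> exists a, A a /\ vnorm (vsub y a) < eps.

Definition comb (l : list (R * X)) : X :=
  fold_right (fun p acc => vadd (vscal (fst p) (snd p)) acc) vzero l.
Definition wsum (l : list (R * X)) : R :=
  fold_right (fun p acc => fst p + acc) 0 l.
Definition conv (A : X -> Prop) (y : X) : Prop :=
  exists l : list (R * X),
    Forall (fun p => 0 <= fst p /\ A (snd p)) l /\ wsum l = 1 /\ y = comb l.

Definition almost_transitive : Prop :=
  forall x, sphere x -> forall y, closure (orbit x) y <-> sphere y.

Definition convex_transitive : Prop :=
  forall x, sphere x -> forall y, closure (conv (orbit x)) y <-> ball y.

Definition uniformly_convex : Prop :=
  forall eps, 0 < eps <= 2 -> exists delta, delta > 0 /\
    forall x y, ball x -> ball y -> vnorm (vsub x y) >= eps ->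
      vnorm (vscal (1/2) (vadd x y)) <= 1 - delta.

Definition smooth_modulus_is (t r : R) : Prop :=
  is_lub (fun s => exists x y, sphere x /\ sphere y /\
     s = (vnorm (vadd x (vscal t y)) + vnorm (vsub x (vscal t y))) / 2 - 1) r.

Definition uniformly_smooth : Prop :=
  forall eps, eps > 0 -> exists delta, delta > 0 /\
    forall t r, 0 < t < delta -> smooth_modulus_is t r -> r / t < eps.

Definition in_J : Prop :=
  almost_transitive /\ uniformly_convex /\ uniformly_smooth.

End Defs.

(* Main.v *)
Require Import Defs.
From Stdlib Require Import Reals.
From Stdlib Require Import Lra Lia List Classical ClassicalEpsilon.
Import ListNotations.
Open Scope R_scope.

(** A slice exposing a point of the weakly open set [U] has diameter less than 2.
    By convex transitivity, [sup_T f (T x) = 1] for every norm-one [f] and every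
    [x] in the sphere, so any two points of the ball with midpoint of norm close to
    1 can be moved into this slice: [X] is uniformly nonsquare.

    Suppose that [X] is not uniformly convex. The orbit of a midpoint of norm almost
    1 of two points at distance [eps] has the ball as closed convex hull, so every
    point of the ball is a barycentre of points at average distance [eps / 2] from
    it; iterating gives an infinite bounded martingale with differences [d_k] of
    norm at least [eps / 2] on average. Uniform nonsquareness gives
    [|x+y|^2 + |x-y|^2 <= (4 - kappa) (|x|^2 + |y|^2)], which passes to
    [Q A = E |sum_k A_k d_k|^2] for finitely supported real sequences [A]. James's
    argument excludes this: [Q] is at most quadratic in the number of blocks on
    alternating block sequences, and averaging two interleaved ones, with sum or
    difference, decreases the bound by a fixed factor while losing at most one block.

    Uniform convexity makes slices small, hence almost transitivity. If [X] were not
    uniformly smooth, almost transitivity would make the norm rough at every point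
    with the same constant, giving a random walk with unit steps whose norm grows
    linearly on average. Comparing the two halves of a walk, uniform convexity makes
    the mean square of the normalized displacement drop by a fixed amount at each
    doubling of the length, a contradiction. *)

(** * Linear identities *)

(** Reflection for the tactic [vec]: two linear expressions agree once the coefficients of each atom
    do, so a vector identity becomes finitely many real equations. *)
Inductive vexpr :=
| VAtom (n : nat) | VZero | VAdd (a b : vexpr) | VOpp (a : vexpr)
| VScal (r : R) (a : vexpr).

Fixpoint veval {X : Banach} (env : list X) (e : vexpr) : X :=
  match e with
  | VAtom n => nth n env vzero
  | VZero => vzero
  | VAdd a b => vadd (veval env a) (veval env b)
  | VOpp a => vopp (veval env a)
  | VScal r a => vscal r (veval env a)
  end.

Fixpoint vcoef (e : vexpr) (i : nat) : R :=
  match e with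
  | VAtom n => if Nat.eqb n i then 1 else 0
  | VZero => 0
  | VAdd a b => vcoef a i + vcoef b i
  | VOpp a => - vcoef a i
  | VScal r a => r * vcoef a i
  end.

Fixpoint lincomb {X : Banach} (c : nat -> R) (env : list X) : X :=
  match env with
  | [] => vzero
  | x :: env' => vadd (vscal (c O) x) (lincomb (fun i => c (S i)) env')
  end.

(** A recursive conjunction, so that [cbn] unfolds it into separate equations when the length is
    concrete. *)
Fixpoint coefs_eq (c d : nat -> R) (n : nat) : Prop :=
  match n with
  | O => True
  | S n => c O = d O /\ coefs_eq (fun i => c (S i)) (fun i => d (S i)) n
  end.

Section VectorSpace.
Context {X : Banach}.
Implicit Types x y z : X.

Lemma vadd_0r x : vadd x vzero = x.
Proof. rewrite vadd_comm; apply vadd_0. Qed.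

Lemma vadd_reg_l x y z : vadd x y = vadd x z -> y = z.
Proof.
  intros H. rewrite <- (vadd_0 _ y), <- (vadd_0 _ z), <- (vadd_opp _ x).
  now rewrite <- !vadd_assoc, H.
Qed.

Lemma vscal_0 x : vscal 0 x = vzero.
Proof.
  apply (vadd_reg_l (vscal 0 x)). rewrite <- vscal_addl, Rplus_0_l.
  now rewrite vadd_0r.
Qed.

Lemma vscal_zero a : vscal a (@vzero X) = vzero.
Proof. rewrite <- (vscal_0 vzero), vscal_assoc. f_equal; ring. Qed.

Lemma vopp_scal x : vopp x = vscal (-1) x.
Proof.
  apply (vadd_reg_l x). rewrite (vadd_comm _ x (vopp x)), vadd_opp.
  transitivity (vadd (vscal 1 x) (vscal (-1) x)); [|now rewrite vscal_1].
  rewrite <- vscal_addl. replace (1 + -1) with 0 by ring. now rewrite vscal_0.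
Qed.

Lemma vadd_swap (a b c d : X) :
  vadd (vadd a b) (vadd c d) = vadd (vadd a c) (vadd b d).
Proof.
  rewrite <- !vadd_assoc. f_equal. rewrite !vadd_assoc. f_equal. apply vadd_comm.
Qed.

Lemma lincomb_add c d (env : list X) :
  lincomb (fun i => c i + d i) env = vadd (lincomb c env) (lincomb d env).
Proof.
  revert c d; induction env as [|x env IH]; intros c d; simpl.
  - now rewrite vadd_0.
  - rewrite vscal_addl, (IH (fun i => c (S i)) (fun i => d (S i))). apply vadd_swap.
Qed.

Lemma lincomb_scal r c (env : list X) :
  lincomb (fun i => r * c i) env = vscal r (lincomb c env).
Proof.
  revert c; induction env as [|x env IH]; intros c; simpl.
  - now rewrite vscal_zero.
  - now rewrite vscal_addr, vscal_assoc, (IH (fun i => c (S i))).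
Qed.

Lemma lincomb_ext c d (env : list X) :
  coefs_eq c d (length env) -> lincomb c env = lincomb d env.
Proof.
  revert c d; induction env as [|x env IH]; intros c d; simpl; [easy|].
  intros [-> H]. now rewrite (IH _ _ H).
Qed.

Lemma coefs_eq_ext c d n : (forall i, c i = d i) -> coefs_eq c d n.
Proof. revert c d; induction n; simpl; auto. Qed.

Lemma lincomb_zero (env : list X) : lincomb (fun _ => 0) env = vzero.
Proof. induction env; simpl; [easy|]. now rewrite IHenv, vscal_0, vadd_0. Qed.

Lemma lincomb_atom n (env : list X) :
  lincomb (fun i => if Nat.eqb n i then 1 else 0) env = nth n env vzero.
Proof.
  revert n; induction env as [|x env IH]; intros [|n]; simpl; try easy.
  - now rewrite vscal_1, lincomb_zero, vadd_0r.
  - now rewrite vscal_0, vadd_0, IH.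
Qed.

Lemma veval_lincomb (env : list X) e : veval env e = lincomb (vcoef e) env.
Proof.
  induction e; simpl.
  - now rewrite lincomb_atom.
  - now rewrite lincomb_zero.
  - now rewrite lincomb_add, IHe1, IHe2.
  - rewrite vopp_scal, IHe, <- lincomb_scal. apply lincomb_ext, coefs_eq_ext.
    intros; ring.
  - now rewrite lincomb_scal, IHe.
Qed.

Lemma veval_eq (env : list X) e1 e2 :
  coefs_eq (vcoef e1) (vcoef e2) (length env) -> veval env e1 = veval env e2.
Proof. intros H. rewrite !veval_lincomb. now apply lincomb_ext. Qed.

End VectorSpace.

Ltac vec_index x env :=
  lazymatch env with
  | x :: _ => constr:(O)
  | _ :: ?env' => let n := vec_index x env' in constr:(S n)
  end.
Ltac vec_mem x env :=
  match env with
  | x :: _ => constr:(true)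
  | _ :: ?env' => vec_mem x env'
  | _ => constr:(false)
  end.
Ltac vec_atoms e env :=
  lazymatch e with
  | vadd ?a ?b => let env := vec_atoms a env in vec_atoms b env
  | vopp ?a => vec_atoms a env
  | vscal _ ?a => vec_atoms a env
  | vzero => env
  | _ => lazymatch vec_mem e env with
         | true => env
         | false => constr:(e :: env)
         end
  end.
Ltac vec_reify e env :=
  lazymatch e with
  | vadd ?a ?b => let a := vec_reify a env in let b := vec_reify b env in
                  constr:(VAdd a b)
  | vopp ?a => let a := vec_reify a env in constr:(VOpp a)
  | vscal ?r ?a => let a := vec_reify a env in constr:(VScal r a)
  | vzero => constr:(VZero)
  | _ => let n := vec_index e env in constr:(VAtom n)
  end.
Ltac vec :=
  unfold vsub;
  lazymatch goal with
  | |- @eq (car ?X) ?a ?b =>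
      let env := vec_atoms a (@nil (car X)) in
      let env := vec_atoms b env in
      let ea := vec_reify a env in
      let eb := vec_reify b env in
      change (veval env ea = veval env eb);
      apply veval_eq; cbn [coefs_eq vcoef length Nat.eqb];
      repeat split; try ring; try (field; lra)
  end.

(** * Elementary norm estimates *)

Section Norm.
Context {X : Banach}.
Implicit Types x y z : X.

Lemma vsub_self x : vsub X x x = vzero.
Proof. vec. Qed.

Lemma vnorm_zero : vnorm (@vzero X) = 0.
Proof. rewrite <- (vscal_0 vzero), vnorm_scal, Rabs_R0. ring. Qed.

Lemma vnorm_opp x : vnorm (vopp x) = vnorm x.
Proof. rewrite vopp_scal, vnorm_scal, Rabs_left by lra. ring. Qed.

Lemma vnorm_ge0 x : 0 <= vnorm x.
Proof.
  pose proof (vnorm_triangle _ (vopp x) x) as H.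
  rewrite vadd_opp, vnorm_zero, vnorm_opp in H. lra.
Qed.

Lemma vnorm_sub_sym x y : vnorm (vsub X x y) = vnorm (vsub X y x).
Proof. rewrite <- vnorm_opp. f_equal. vec. Qed.

Lemma vnorm_le_add x y z : z = vadd x y -> vnorm z <= vnorm x + vnorm y.
Proof. intros ->. apply vnorm_triangle. Qed.

Lemma vnorm_le_sub x y z : z = vsub X x y -> vnorm z <= vnorm x + vnorm y.
Proof. intros ->. rewrite <- (vnorm_opp y). apply vnorm_triangle. Qed.

Lemma vnorm_scal_pos a x : 0 <= a -> vnorm (vscal a x) = a * vnorm x.
Proof. intros H. now rewrite vnorm_scal, Rabs_pos_eq. Qed.

Lemma vnorm_normalize x : 0 < vnorm x -> vnorm (vscal (/ vnorm x) x) = 1.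
Proof.
  intros H. rewrite vnorm_scal_pos.
  - now apply Rinv_l, Rgt_not_eq.
  - now apply Rlt_le, Rinv_0_lt_compat.
Qed.

End Norm.

(** * James's block argument *)

(** The threshold of each entry may depend on the earlier entries: this plays the part of an
    iterated limit along rapidly increasing indices. *)
Fixpoint ev_seq (m : nat) (P : list nat -> Prop) : Prop :=
  match m with
  | O => P []
  | S m => exists M, forall r, (M <= r)%nat -> ev_seq m (fun l => P (r :: l))
  end.

Lemma ev_seq_mono m P Q : (forall l, P l -> Q l) -> ev_seq m P -> ev_seq m Q.
Proof.
  revert P Q; induction m as [|m IH]; simpl; intros P Q H; [apply H|].
  intros [M HM]. exists M. intros r Hr. apply (IH (fun l => P (r :: l))); auto.
Qed.

Lemma ev_seq_and m P Q :
  ev_seq m P -> ev_seq m Q -> ev_seq m (fun l => P l /\ Q l).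
Proof.
  revert P Q; induction m as [|m IH]; simpl; intros P Q; [easy|].
  intros [M HM] [M' HM']. exists (max M M'). intros r Hr.
  apply IH; [apply HM | apply HM']; lia.
Qed.

Lemma ev_seq_ex m P : ev_seq m P -> exists l, length l = m /\ P l.
Proof.
  revert P; induction m as [|m IH]; simpl; intros P.
  - now exists [].
  - intros [M HM]. destruct (IH _ (HM M (le_n M))) as (l & <- & Hl).
    now exists (M :: l).
Qed.

Fixpoint increasing (a : nat) (l : list nat) : Prop :=
  match l with
  | [] => True
  | b :: l' => (a < b)%nat /\ increasing b l'
  end.

Lemma ev_seq_increasing m a : ev_seq m (increasing a).
Proof.
  revert a; induction m as [|m IH]; simpl; intros a; [easy|].
  exists (S a). intros r Hr. apply (ev_seq_mono _ (increasing r)); [|apply IH].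
  intros l Hl. split; [lia|easy].
Qed.

Fixpoint select (mask : list bool) (l : list nat) : list nat :=
  match mask, l with
  | b :: mask', r :: l' => if b then r :: select mask' l' else select mask' l'
  | _, _ => []
  end.

(** Unselected entries are unconstrained, and the threshold of a selected one depends only on the
    selected ones before it. Properties of different sublists can thus be imposed on one common
    list. *)
Lemma ev_seq_select mask P :
  ev_seq (count_occ Bool.bool_dec mask true) P ->
  ev_seq (length mask) (fun l => P (select mask l)).
Proof.
  revert P; induction mask as [|[|] mask IH]; simpl; intros P; [easy| |].
  - intros [M HM]. exists M. intros r Hr. apply (IH (fun l => P (r :: l))). auto.
  - intros H. exists O. intros r _. now apply IH.
Qed.

(** The entries will be left and right endpoints of intervals in turn; raising a left one or
    lowering a right one shrinks an interval. The flag [b] is [true] when a left endpoint comes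
    first. *)
Fixpoint alt_mono (b : bool) (m : nat) (P : list nat -> Prop) : Prop :=
  match m with
  | O => True
  | S m =>
      (forall r r' l, (r <= r')%nat ->
         if b then P (r :: l) -> P (r' :: l) else P (r' :: l) -> P (r :: l)) /\
      forall r, alt_mono (negb b) m (fun l => P (r :: l))
  end.

Lemma alt_mono_ext b m P Q :
  (forall l, P l <-> Q l) -> alt_mono b m P -> alt_mono b m Q.
Proof.
  revert b P Q; induction m as [|m IH]; simpl; intros b P Q H; [easy|].
  intros [H1 H2]. split.
  - intros r r' l Hr. specialize (H1 r r' l Hr).
    destruct b; intros HQ; apply H, H1, H, HQ.
  - intros r. apply (IH _ (fun l => P (r :: l))); auto.
Qed.

(* Alternating monotonicity makes the nested "eventually" quantifier commute
   with negation, which is what replaces Ramsey's theorem or an ultrafilter. *)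
Lemma alt_mono_dichotomy b m P :
  alt_mono b m P -> ev_seq m P \/ ev_seq m (fun l => ~ P l).
Proof.
  revert b P; induction m as [|m IH]; simpl; intros b P; [intros; apply classic|].
  intros [H1 H2].
  assert (D : forall r, ev_seq m (fun l => P (r :: l)) \/
                        ev_seq m (fun l => ~ P (r :: l))) by eauto.
  destruct b.
  (* If some [r0] works, monotonicity extends it to all larger [r]; if none does, the dichotomy for
     the tail gives the negation at every [r]. *)
  - destruct (classic (exists r, ev_seq m (fun l => P (r :: l)))) as [[r0 H]|H].
    + left. exists r0. intros r Hr. revert H. apply ev_seq_mono.
      intros l. now apply H1.
    + right. exists O. intros r _. destruct (D r); [|easy]. exfalso; eauto.
  - destruct (classic (exists r, ev_seq m (fun l => ~ P (r :: l)))) as [[r0 H]|H].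
    + right. exists r0. intros r Hr. revert H. apply ev_seq_mono.
      intros l HP HQ. apply HP. revert HQ. now apply H1.
    + left. exists O. intros r _. destruct (D r); [easy|]. exfalso; eauto.
Qed.

(** * Alternating block sequences and their interleaving *)

Fixpoint block_signs (s : R) (l : list nat) (A : nat -> R) : Prop :=
  match l with
  | p :: q :: l' =>
      (forall k, (p <= k < q)%nat -> A k = s) /\ block_signs (- s) l' A
  | _ => True
  end.

(** Shrinking an interval weakens the constraint on [A], whose values off the intervals are free.
    The arbitrary condition [C] absorbs the intervals already completed; the second half treats
    lists whose first left endpoint [p] is fixed. *)
Lemma block_signs_ex_mono m :
  (forall s C, alt_mono true m (fun l => exists A, block_signs s l A /\ C A)) /\
  (forall s C p,
     alt_mono false m (fun l => exists A, block_signs s (p :: l) A /\ C A)).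
Proof.
  induction m as [|m [IH1 IH2]]; [now split|]. split; intros s C.
  - split.
    + intros r r' [|q l] Hr (A & HA & HC); exists A; split; auto.
      destruct HA as [HA HA']. split; auto. intros k Hk. apply HA. lia.
    + intros r. apply IH2.
  - intros p. split.
    + intros r r' l Hr (A & [HA HA'] & HC). exists A. split; auto. split; auto.
      intros k Hk. apply HA. lia.
    + intros r.
      apply (alt_mono_ext _ _
        (fun l => exists A, block_signs (- s) l A /\
           ((forall k, (p <= k < r)%nat -> A k = s) /\ C A))); [|apply IH1].
      intros l. simpl. firstorder.
Qed.

Fixpoint repeat_mask (b e : list bool) (m : nat) : list bool :=
  match m with
  | O => e
  | S m => b ++ repeat_mask b e m
  end.

Lemma repeat_mask_length b e m :
  length (repeat_mask b e m) = (m * length b + length e)%nat.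
Proof. induction m; simpl; [lia|]. rewrite length_app, IHm. lia. Qed.

Lemma repeat_mask_count b e m :
  count_occ Bool.bool_dec (repeat_mask b e m) true =
  (m * count_occ Bool.bool_dec b true + count_occ Bool.bool_dec e true)%nat.
Proof. induction m; simpl; [lia|]. rewrite count_occ_app, IHm. lia. Qed.

(* The increasing sequence p1 q1 | p2 p3 q2 q3 | p4 p5 q4 q5 | ... | p q is split
   into the intervals I_i = [p_(2i-1), p_2i) and J_i = [q_(2i-1), q_2i), and into
   the intersections I_i /\ J_i and I_(i+1) /\ J_i. *)
Definition mask_I := repeat_mask [true; true; false; false] [true; false].
Definition mask_J := repeat_mask [false; false; true; true] [false; true].
Definition mask_IJ := repeat_mask [true; false; false; true] [true; false].
Definition mask_IJ' := repeat_mask [false; true; true; false] [false; false].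

(** On I_i /\ J_i the two sequences have the same sign, so the half-sum keeps it; on I_(i+1) /\ J_i
    they have opposite signs, and the half-difference keeps that of [B]. This leaves [m + 1] blocks
    for the half-sum and [m] for the half-difference. *)
Lemma block_signs_interleave m p q l s A B :
  length l = (4 * m + 2)%nat -> increasing p (q :: l) ->
  block_signs s (p :: select (mask_I m) l) A ->
  block_signs s (q :: select (mask_J m) l) B ->
  block_signs s (q :: select (mask_IJ m) l) (fun k => (A k + B k) / 2) /\
  block_signs s (select (mask_IJ' m) l) (fun k => (B k - A k) / 2).
Proof.
  revert p q l s; induction m as [|m IH]; intros p q l s Hl Hinc HA HB.
  - destruct l as [|a [|b [|]]]; simpl in Hl; try lia.
    simpl in *. destruct Hinc as (? & ? & ? & _).
    repeat split. intros k Hk. rewrite (proj1 HA), (proj1 HB) by lia. lra.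
  - destruct l as [|a [|b [|c [|d l]]]]; simpl in Hl; try lia.
    change (block_signs s (p :: a :: b :: select (mask_I m) l) A) in HA.
    change (block_signs s (q :: c :: d :: select (mask_J m) l) B) in HB.
    change (block_signs s (q :: a :: d :: select (mask_IJ m) l)
              (fun k => (A k + B k) / 2) /\
            block_signs s (b :: c :: select (mask_IJ' m) l)
              (fun k => (B k - A k) / 2)).
    destruct Hinc as (? & ? & ? & ? & ? & Hinc).
    destruct HA as [HA HA'], HB as [HB HB'].
    destruct (IH b d l (- s)) as [G1 G2]; auto; [lia|split; [lia|easy]|].
    split; split; auto.
    + intros k Hk. rewrite HA, HB by lia. lra.
    (* The next interval of [A] opens at [b] and closes at the head [e] of the remaining list, which
       lies beyond [c]. *)
    + assert (HA2 : forall k, (b <= k < c)%nat -> A k = - s).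
      { destruct l as [|e l]; [simpl in Hl; lia|]. intros k Hk.
        destruct m; simpl in HA', Hinc; apply (proj1 HA'); lia. }
      intros k Hk. rewrite HA2, HB by lia. lra.
Qed.

(** * Standard alternating sequences *)

Definition below (p k : nat) : R := if Nat.ltb k p then 1 else 0.

(** Indicators of intervals are written as differences of initial segments, so that a martingale
    transform by a wave is a signed sum of differences of stopped values. *)
Fixpoint wave (s : R) (l : list nat) (k : nat) : R :=
  match l with
  | p :: q :: l' => s * (below q k - below p k) + wave (- s) l' k
  | _ => 0
  end.

Lemma below_1 p k : (k < p)%nat -> below p k = 1.
Proof. intros H. unfold below. now rewrite (proj2 (Nat.ltb_lt k p)). Qed.

Lemma below_0 p k : (p <= k)%nat -> below p k = 0.
Proof. intros H. unfold below. now rewrite (proj2 (Nat.ltb_ge k p)). Qed.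

Lemma list_pair_ind {T} (P : list T -> Prop) :
  P [] -> (forall a, P [a]) -> (forall a b l, P l -> P (a :: b :: l)) ->
  forall l, P l.
Proof.
  intros H0 H1 H2 l. enough (P l /\ forall a, P (a :: l)) by easy.
  induction l as [|a l [IH IH']]; auto.
Qed.

Lemma wave_0_before a k s l : increasing a l -> (k <= a)%nat -> wave s l k = 0.
Proof.
  revert a s; induction l as [|x|p q l IH] using list_pair_ind; intros a s H Hk;
    simpl in *; auto.
  destruct H as (? & ? & H). rewrite !below_1, (IH q) by (easy || lia). ring.
Qed.

Lemma wave_0_after l : exists N, forall s k, (N <= k)%nat -> wave s l k = 0.
Proof.
  induction l as [|x|p q l [N IH]] using list_pair_ind.
  - now exists O.
  - now exists O.
  - exists (max N (max p q)). intros s k Hk. simpl.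
    rewrite !below_0, IH by lia. ring.
Qed.

Lemma block_signs_ext s l a A B :
  increasing a l -> (forall k, (a < k)%nat -> A k = B k) ->
  block_signs s l A -> block_signs s l B.
Proof.
  revert a s; induction l as [|x|p q l IH] using list_pair_ind; intros a s H HAB;
    simpl in *; auto.
  destruct H as (? & ? & H). intros [G1 G2]. split.
  - intros k Hk. rewrite <- HAB by lia. auto.
  - apply (IH q); auto. intros k Hk. apply HAB. lia.
Qed.

Lemma block_signs_wave s l a : increasing a l -> block_signs s l (wave s l).
Proof.
  revert a s; induction l as [|x|p q l IH] using list_pair_ind; intros a s H;
    simpl in *; auto.
  destruct H as (? & ? & H). split.
  - intros k Hk. rewrite below_1, below_0, (wave_0_before q) by (easy || lia). ring.
  - apply (block_signs_ext _ _ q (wave (- s) l)); auto; [|now apply (IH q)].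
    intros k Hk. rewrite !below_0 by lia. ring.
Qed.

(** With [t] the square root and [u] the fourth root of [r], one has r^j = t^j (u^j)^2. Bernoulli's
    inequality bounds (j + 1) u^j, and the factor t^j tends to 0. *)
Lemma geometric_beats_quadratic r K c :
  0 < r < 1 -> 0 < c -> exists j, r ^ j * (K * INR (S j) ^ 2) < c.
Proof.
  intros Hr Hc.
  assert (Hs : 0 < sqrt r) by (apply sqrt_lt_R0; lra).
  assert (Hss : sqrt r * sqrt r = r) by (apply sqrt_sqrt; lra).
  assert (Hs1 : sqrt r < 1) by nra.
  set (t := sqrt r) in *.
  assert (Ht : 0 < sqrt t) by (apply sqrt_lt_R0; lra).
  assert (Htt : sqrt t * sqrt t = t) by (apply sqrt_sqrt; lra).
  assert (Ht1 : sqrt t < 1) by nra.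
  set (u := sqrt t) in *.
  set (h := / u - 1).
  assert (Hu : 1 < / u) by (rewrite <- Rinv_1; apply Rinv_lt_contravar; lra).
  assert (Hh : 0 < h) by (unfold h; lra).
  assert (Hb : forall j, INR (S j) * u ^ j * Rmin h 1 <= 1).
  { intros j.
    assert (Hp : 0 < u ^ j) by now apply pow_lt.
    assert (Hq : u ^ j * (/ u) ^ j = 1).
    { rewrite <- Rpow_mult_distr, Rinv_r, pow1; lra. }
    assert (HB : 1 + INR j * h <= (/ u) ^ j).
    { replace (/ u) with (1 + h) by (unfold h; ring). now apply poly. }
    rewrite S_INR. pose proof (pos_INR j).
    assert (Hm1 := Rmin_l h 1). assert (Hm2 := Rmin_r h 1).
    assert ((INR j + 1) * Rmin h 1 <= (/ u) ^ j) by nra. nra. }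
  set (m := Rmin h 1) in *.
  assert (Hm : 0 < m) by (apply Rmin_glb_lt; lra).
  destruct (pow_lt_1_zero t) with (y := c * m ^ 2 / (Rabs K + 1)) as [j Hj].
  { rewrite Rabs_pos_eq; lra. }
  { pose proof (Rabs_pos K). apply Rdiv_lt_0_compat; [|lra].
    apply Rmult_lt_0_compat; [easy|]. now apply pow_lt. }
  exists j. specialize (Hj j (le_n j)). specialize (Hb j).
  assert (Hru : r ^ j = t ^ j * (u ^ j * u ^ j)).
  { rewrite <- Hss, <- Htt at 1. rewrite !Rpow_mult_distr.
    rewrite <- Htt, !Rpow_mult_distr. ring. }
  assert (Htj : 0 < t ^ j) by now apply pow_lt.
  assert (Huj : 0 < u ^ j) by now apply pow_lt.
  rewrite Rabs_pos_eq in Hj by lra.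
  pose proof (Rabs_pos K). pose proof (Rle_abs K).
  apply (Rmult_lt_compat_r (Rabs K + 1)) in Hj; [|lra].
  unfold Rdiv in Hj. rewrite Rmult_assoc, Rinv_l, Rmult_1_r in Hj by lra.
  set (w := INR (S j) * u ^ j) in *.
  assert (Hw : 0 <= w) by (apply Rmult_le_pos; [apply pos_INR|lra]).
  assert (Hwm : (w * m) ^ 2 <= 1).
  { pose proof (Rmult_le_pos w m Hw (Rlt_le _ _ Hm)).
    generalize dependent (w * m). intros; nra. }
  assert (Hm2 : 0 < m ^ 2) by now apply pow_lt.
  apply (Rmult_lt_reg_r (m ^ 2)); [easy|].
  apply Rle_lt_trans with (t ^ j * (Rabs K + 1)); [|easy].
  replace (r ^ j * (K * INR (S j) ^ 2) * m ^ 2) with (t ^ j * K * (w * m) ^ 2)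
    by (rewrite Hru; unfold w; ring).
  apply Rle_trans with (t ^ j * (Rabs K + 1) * (w * m) ^ 2).
  - apply Rmult_le_compat_r; [nra|]. apply Rmult_le_compat_l; lra.
  - rewrite <- (Rmult_1_r (t ^ j * (Rabs K + 1))) at 2.
    apply Rmult_le_compat_l; [|easy]. apply Rmult_le_pos; lra.
Qed.

(** * Contradiction for a nonsquare functional on sequences *)

Section James.
Variables (Q : nat -> (nat -> R) -> R) (r c K : R).
Hypothesis r_range : 0 < r < 1.
Hypothesis c_pos : 0 < c.
Hypothesis Q_nonsquare : forall N A B,
  Q N (fun k => (A k + B k) / 2) + Q N (fun k => (B k - A k) / 2)
  <= r * (Q N A + Q N B).
Hypothesis Q_pad : forall N M A, (forall k, (N <= k)%nat -> A k = 0) ->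
  (N <= M)%nat -> Q M A = Q N A.
Hypothesis Q_lower : forall N A j, (j < N)%nat -> A j = 1 -> c <= Q N A.
Hypothesis Q_wave : forall N l, Q N (wave 1 l) <= K * INR (length l) ^ 2.

(** By [Q_pad] the value does not depend on the cutoff [N] once it is beyond the support.
    Quantifying over [A] keeps the property alternately monotone in the endpoints. *)
Definition small_block (v : R) (l : list nat) : Prop :=
  exists A, block_signs 1 l A /\
    exists N, (forall k, (N <= k)%nat -> A k = 0) /\ Q N A <= v.

(** If both alternatives failed, the dichotomy would make their negations eventual too. Two
    interleaved small sequences then contradict [Q_nonsquare]: their half-sum or their
    half-difference has value at most [r * v]. *)
Lemma small_block_step m v :
  ev_seq (2 * S m) (small_block v) ->
  ev_seq (2 * S m) (small_block (r * v)) \/ ev_seq (2 * m) (small_block (r * v)).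
Proof.
  intros H.
  destruct (alt_mono_dichotomy true (2 * S m) (small_block (r * v))) as [|H1];
    [apply block_signs_ex_mono|now left|].
  destruct (alt_mono_dichotomy true (2 * m) (small_block (r * v))) as [|H2];
    [apply block_signs_ex_mono|now right|].
  exfalso.
  (* The four sublists are drawn from one list of [4 * m + 4] endpoints, whose first two entries are
     [p] and [q]. *)
  assert (HI : ev_seq (4 * m + 4)
    (fun l => small_block v (select (true :: false :: mask_I m) l))).
  { replace (4 * m + 4)%nat with (length (true :: false :: mask_I m))
      by (simpl; unfold mask_I; rewrite repeat_mask_length; simpl; lia).
    apply (ev_seq_select _ (small_block v)). revert H.
    replace (count_occ _ _ _) with (2 * S m)%nat; [easy|].
    simpl. unfold mask_I. rewrite repeat_mask_count. simpl. lia. }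
  assert (HJ : ev_seq (4 * m + 4)
    (fun l => small_block v (select (false :: true :: mask_J m) l))).
  { replace (4 * m + 4)%nat with (length (false :: true :: mask_J m))
      by (simpl; unfold mask_J; rewrite repeat_mask_length; simpl; lia).
    apply (ev_seq_select _ (small_block v)). revert H.
    replace (count_occ _ _ _) with (2 * S m)%nat; [easy|].
    simpl. unfold mask_J. rewrite repeat_mask_count. simpl. lia. }
  assert (HIJ : ev_seq (4 * m + 4)
    (fun l => ~ small_block (r * v) (select (false :: true :: mask_IJ m) l))).
  { replace (4 * m + 4)%nat with (length (false :: true :: mask_IJ m))
      by (simpl; unfold mask_IJ; rewrite repeat_mask_length; simpl; lia).
    apply (ev_seq_select _ (fun l => ~ small_block (r * v) l)). revert H1.
    replace (count_occ _ _ _) with (2 * S m)%nat; [easy|].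
    simpl. unfold mask_IJ. rewrite repeat_mask_count. simpl. lia. }
  assert (HIJ' : ev_seq (4 * m + 4)
    (fun l => ~ small_block (r * v) (select (false :: false :: mask_IJ' m) l))).
  { replace (4 * m + 4)%nat with (length (false :: false :: mask_IJ' m))
      by (simpl; unfold mask_IJ'; rewrite repeat_mask_length; simpl; lia).
    apply (ev_seq_select _ (fun l => ~ small_block (r * v) l)). revert H2.
    replace (count_occ _ _ _) with (2 * m)%nat; [easy|].
    simpl. unfold mask_IJ'. rewrite repeat_mask_count. simpl. lia. }
  pose proof (ev_seq_and _ _ _ (ev_seq_increasing (4 * m + 4) 0)
    (ev_seq_and _ _ _ (ev_seq_and _ _ _ HI HJ) (ev_seq_and _ _ _ HIJ HIJ')))
    as Hall.
  destruct (ev_seq_ex _ _ Hall)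
    as (l & Hl & Hinc & [(A & HA & NA & HA0 & HQA) (B & HB & NB & HB0 & HQB)] &
        [F1 F2]).
  destruct l as [|p [|q l]]; simpl in Hl; try lia.
  destruct (block_signs_interleave m p q l 1 A B) as [G1 G2]; auto;
    [lia|apply Hinc|].
  set (N := max NA NB).
  pose proof (Q_nonsquare N A B) as HN.
  rewrite (Q_pad NA N A), (Q_pad NB N B) in HN by (auto; lia).
  destruct (Rle_dec (Q N (fun k => (A k + B k) / 2)) (r * v)) as [L|L].
  - apply F1. exists (fun k => (A k + B k) / 2). split; [exact G1|].
    exists N. split; [|easy]. intros k Hk. rewrite HA0, HB0 by lia. lra.
  - apply F2. exists (fun k => (B k - A k) / 2). split; [exact G2|].
    exists N. split; [|nra]. intros k Hk. rewrite HA0, HB0 by lia. lra.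
Qed.

(** Starting from [j + 1] blocks, [j] steps leave at least one block, on which [Q_lower] applies,
    while the bound has dropped below [c]. *)
Lemma james_contradiction : False.
Proof.
  (* The factor 4 appears because [j + 1] blocks have [2 * S j] endpoints and [Q_wave] counts
     endpoints. *)
  destruct (geometric_beats_quadratic r (4 * K) c) as [j Hj]; auto.
  set (v := K * INR (2 * S j) ^ 2).
  assert (H0 : ev_seq (2 * S j) (small_block v)).
  { pose proof (ev_seq_increasing (2 * S j) 0) as H.
    assert (HL : ev_seq (2 * S j) (fun l => length l = (2 * S j)%nat)).
    { generalize (2 * S j)%nat. induction n as [|n IH]; simpl; [easy|].
      exists O. intros _ _. revert IH. apply ev_seq_mono. intros l ->. easy. }
    generalize (ev_seq_and _ _ _ H HL). apply ev_seq_mono. intros l [Hl HL'].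
    exists (wave 1 l). split; [now apply (block_signs_wave 1 l O)|].
    destruct (wave_0_after l) as [N HN]. exists N. split; [auto|].
    unfold v. rewrite <- HL'. apply Q_wave. }
  assert (H : forall i, (i <= j)%nat -> exists m, (j <= i + m)%nat /\
    ev_seq (2 * S m) (small_block (r ^ i * v))).
  { induction i as [|i IH]; intros Hi.
    - exists j. split; [lia|]. simpl. now rewrite Rmult_1_l.
    - destruct IH as (m & Hm & IH); [lia|].
      simpl. rewrite Rmult_assoc.
      destruct (small_block_step _ _ IH) as [G|G].
      + exists m. split; [lia|easy].
      + destruct m as [|m]; [lia|]. exists m. split; [lia|easy]. }
  destruct (H j (le_n j)) as (m & _ & Hm).
  destruct (ev_seq_ex _ _ (ev_seq_and _ _ _ (ev_seq_increasing (2 * S m) 0) Hm))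
    as (l & Hl & Hinc & A & HA & N & HN & HQ).
  destruct l as [|p [|q l]]; simpl in Hl; try lia.
  destruct Hinc as (_ & Hpq & _). destruct HA as [HA _].
  assert (Hp : A p = 1) by (apply HA; lia).
  assert (HpN : (p < N)%nat).
  { destruct (Nat.lt_ge_cases p N) as [|G]; [easy|]. specialize (HN p G). lra. }
  pose proof (Q_lower N A p HpN Hp).
  assert (v = 4 * K * INR (S j) ^ 2).
  { unfold v. rewrite mult_INR. simpl (INR 2). ring. }
  rewrite H2 in HQ. lra.
Qed.

End James.

(** * Finite convex combinations *)

Section Averages.
Context {X : Banach}.
Implicit Types (x y s : X) (L : list (R * X)) (phi psi : X -> R).

Definition avg L phi : R := fold_right (fun p acc => fst p * phi (snd p) + acc) 0 L.

Definition nonneg_weights L : Prop := forall p, In p L -> 0 <= fst p.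

Lemma avg_le L phi psi :
  nonneg_weights L -> (forall p, In p L -> phi (snd p) <= psi (snd p)) ->
  avg L phi <= avg L psi.
Proof.
  unfold nonneg_weights.
  induction L as [|p L IH]; simpl; intros Hw H; [lra|].
  apply Rplus_le_compat; [apply Rmult_le_compat_l|]; auto.
Qed.

Lemma avg_ext L phi psi :
  (forall p, In p L -> phi (snd p) = psi (snd p)) -> avg L phi = avg L psi.
Proof.
  induction L as [|p L IH]; simpl; intros H; [easy|]. rewrite IH, H; auto.
Qed.

Lemma avg_lin L a b phi psi :
  avg L (fun u => a * phi u + b * psi u) = a * avg L phi + b * avg L psi.
Proof. induction L as [|p L IH]; simpl; [ring|]. rewrite IH. ring. Qed.

Lemma avg_const L a : avg L (fun _ => a) = wsum X L * a.
Proof. induction L as [|p L IH]; simpl; [ring|]. rewrite IH. ring. Qed.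

Lemma avg_app L L' phi : avg (L ++ L') phi = avg L phi + avg L' phi.
Proof. induction L as [|p L IH]; simpl; [ring|]. rewrite IH. ring. Qed.

Lemma wsum_app L L' : wsum X (L ++ L') = wsum X L + wsum X L'.
Proof. induction L as [|p L IH]; simpl; [ring|]. rewrite IH. ring. Qed.

Lemma comb_app L L' : comb X (L ++ L') = vadd (comb X L) (comb X L').
Proof. induction L as [|p L IH]; simpl; [vec|]. rewrite IH. vec. Qed.

Definition rescale a (g : X -> X) L := map (fun p => (a * fst p, g (snd p))) L.

Lemma wsum_rescale a g L : wsum X (rescale a g L) = a * wsum X L.
Proof. induction L as [|p L IH]; simpl; [ring|]. rewrite IH. ring. Qed.

Lemma avg_rescale a g L phi :
  avg (rescale a g L) phi = a * avg L (fun u => phi (g u)).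
Proof. induction L as [|p L IH]; simpl; [ring|]. rewrite IH. ring. Qed.

(** Weighting [s] by [wsum X L] gives a homogeneous form of Jensen's inequality for the norm, which
    passes from a list to its tail. *)
Lemma avg_jensen L s a :
  nonneg_weights L ->
  vnorm (vadd (vscal (wsum X L) s) (vscal a (comb X L)))
  <= avg L (fun u => vnorm (vadd s (vscal a u))).
Proof.
  unfold nonneg_weights. induction L as [|p L IH]; simpl; intros Hw.
  - replace (vadd _ _) with (@vzero X) by vec. rewrite vnorm_zero. lra.
  - rewrite <- vnorm_scal_pos by auto.
    eapply Rle_trans; [|apply Rplus_le_compat_l, IH; auto].
    apply vnorm_le_add. vec.
Qed.

Lemma avg_jensen_centered L x s a :
  nonneg_weights L -> wsum X L = 1 -> comb X L = x ->
  vnorm s <= avg L (fun u => vnorm (vadd s (vscal a (vsub X u x)))).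
Proof.
  intros Hw H1 Hx.
  rewrite (avg_ext _ _ (fun u => vnorm (vadd (vsub X s (vscal a x)) (vscal a u))))
    by (intros; f_equal; vec).
  eapply Rle_trans; [|now apply avg_jensen]. rewrite H1, Hx.
  right. f_equal. vec.
Qed.

End Averages.

(** * Martingales indexed by the paths of a tree *)

Section Bush.
Context {X : Banach}.
Variables (ch : nat -> X -> list (R * X)) (rad : nat -> R) (th : R).
Hypothesis ch_pos : forall k x, nonneg_weights (ch k x).
Hypothesis ch_sum : forall k x, wsum X (ch k x) = 1.
Hypothesis ch_comb : forall k x, comb X (ch k x) = x.
Hypothesis ch_rad : forall k x, vnorm x <= rad k ->
  forall p, In p (ch k x) -> vnorm (snd p) <= rad (S k).
Hypothesis rad_2 : forall k, rad k <= 2.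
Hypothesis th_pos : 0 < th.
Hypothesis ch_spread : forall k x,
  th <= avg (ch k x) (fun u => vnorm (vsub X u x)).

(** Expectation over the [n] states visited after the state [x] at time [k]. *)
Fixpoint EP (n k : nat) (x : X) (phi : list X -> R) : R :=
  match n with
  | O => phi []
  | S n => avg (ch k x) (fun u => EP n (S k) u (fun l => phi (u :: l)))
  end.

Fixpoint bounded_path (k : nat) (l : list X) : Prop :=
  match l with
  | [] => True
  | u :: l' => vnorm u <= rad k /\ bounded_path (S k) l'
  end.

Lemma EP_le_bounded n k x phi psi : vnorm x <= rad k ->
  (forall l, bounded_path (S k) l -> phi l <= psi l) ->
  EP n k x phi <= EP n k x psi.
Proof.
  revert k x phi psi; induction n as [|n IH]; simpl; intros k x phi psi Hx H.
  - now apply H.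
  - apply avg_le; auto. intros p Hp. apply IH; [now apply (ch_rad k x)|].
    intros l Hl. apply H. split; [now apply (ch_rad k x)|easy].
Qed.

Lemma EP_le n k x phi psi :
  (forall l, phi l <= psi l) -> EP n k x phi <= EP n k x psi.
Proof.
  revert k x phi psi; induction n as [|n IH]; simpl; intros k x phi psi H; auto.
  apply avg_le; auto.
Qed.

Lemma EP_ext n k x phi psi :
  (forall l, phi l = psi l) -> EP n k x phi = EP n k x psi.
Proof. intros H. apply Rle_antisym; apply EP_le; intros l; rewrite H; lra. Qed.

Lemma EP_lin n k x a b phi psi :
  EP n k x (fun l => a * phi l + b * psi l) = a * EP n k x phi + b * EP n k x psi.
Proof.
  revert k x phi psi; induction n as [|n IH]; simpl; intros k x phi psi; [easy|].
  rewrite <- avg_lin. apply avg_ext. intros; apply IH.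
Qed.

Lemma EP_const n k x a : EP n k x (fun _ => a) = a.
Proof.
  revert k x; induction n as [|n IH]; simpl; intros k x; [easy|].
  rewrite (avg_ext _ _ (fun _ => a)) by (intros; apply IH).
  rewrite avg_const, ch_sum. ring.
Qed.

(** The martingale transform: the increments along the path, starting at time [k] in state [x], are
    weighted by [A]. *)
Fixpoint transform (A : nat -> R) (k : nat) (x : X) (l : list X) : X :=
  match l with
  | [] => vzero
  | u :: l' => vadd (vscal (A k) (vsub X u x)) (transform A (S k) u l')
  end.

Lemma transform_lin A B a b k x l :
  transform (fun j => a * A j + b * B j) k x l =
  vadd (vscal a (transform A k x l)) (vscal b (transform B k x l)).
Proof.
  revert k x; induction l as [|u l IH]; simpl; intros k x; [vec|].
  rewrite IH. vec.
Qed.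

Lemma transform_ext A B k x l :
  (forall j, A j = B j) -> transform A k x l = transform B k x l.
Proof.
  intros H. revert k x; induction l as [|u l IH]; simpl; intros k x; [easy|].
  now rewrite H, IH.
Qed.

Lemma transform_0 A k x l :
  (forall j, (k <= j)%nat -> A j = 0) -> transform A k x l = vzero.
Proof.
  revert k x; induction l as [|u l IH]; simpl; intros k x H; [easy|].
  rewrite H, IH by (auto; intros; apply H; lia). vec.
Qed.

Lemma EP_pad n m k x (phi : X -> R) A :
  (forall j, (k + n <= j)%nat -> A j = 0) ->
  EP (n + m) k x (fun l => phi (transform A k x l)) =
  EP n k x (fun l => phi (transform A k x l)).
Proof.
  revert k x phi; induction n as [|n IH]; simpl; intros k x phi H.
  - rewrite (EP_ext _ _ _ _ (fun _ => phi vzero)); [apply EP_const|].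
    intros l. rewrite transform_0; [easy|]. intros; apply H; lia.
  - apply avg_ext. intros p _.
    apply (IH (S k) (snd p)
             (fun y => phi (vadd (vscal (A k) (vsub X (snd p) x)) y))).
    intros; apply H; lia.
Qed.

(** Increments have conditional mean zero, so Jensen's inequality applies at each step. *)
Lemma EP_transform_ge n k x A s :
  vnorm s <= EP n k x (fun l => vnorm (vadd s (transform A k x l))).
Proof.
  revert k x s; induction n as [|n IH]; simpl; intros k x s.
  - right. f_equal. vec.
  - eapply Rle_trans; [apply (avg_jensen_centered (ch k x) x s (A k)); auto|].
    apply avg_le; auto. intros p _. eapply Rle_trans; [apply IH|].
    right. apply EP_ext. intros l. f_equal. vec.
Qed.

(** At time [j] the mean norm [M] of [s] plus the increment is at least the norm of [s], and [M]
    plus that norm is at least [th]; hence [M] is at least [th / 2]. Later steps cannot lower the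
    mean norm, and earlier ones are handled by conditioning. *)
Lemma EP_transform_lower n k x A s j :
  (k <= j < k + n)%nat -> A j = 1 ->
  th / 2 <= EP n k x (fun l => vnorm (vadd s (transform A k x l))).
Proof.
  revert k x s; induction n as [|n IH]; simpl; intros k x s Hj HA; [lia|].
  destruct (Nat.eq_dec k j) as [<-|Hne].
  - set (M := avg (ch k x) (fun u => vnorm (vadd s (vscal (A k) (vsub X u x))))).
    assert (H1 : vnorm s <= M) by (apply avg_jensen_centered; auto).
    assert (H2 : th <= M + vnorm s).
    { eapply Rle_trans; [apply (ch_spread k x)|].
      replace (M + vnorm s) with (1 * M + 1 * (wsum X (ch k x) * vnorm s))
        by (rewrite ch_sum; ring).
      unfold M. rewrite <- avg_const, <- avg_lin. apply avg_le; auto.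
      intros p _. rewrite !Rmult_1_l. apply vnorm_le_sub. rewrite HA. vec. }
    apply Rle_trans with M; [lra|].
    apply avg_le; auto. intros p _.
    eapply Rle_trans; [apply (EP_transform_ge n (S k) (snd p) A)|].
    right. apply EP_ext. intros l. f_equal. vec.
  - rewrite <- (Rmult_1_l (th / 2)), <- (ch_sum k x), <- avg_const.
    apply avg_le; auto. intros p _.
    eapply Rle_trans; [apply (IH (S k) (snd p)
      (vadd s (vscal (A k) (vsub X (snd p) x)))); auto; lia|].
    right. apply EP_ext. intros l. f_equal. vec.
Qed.

(** The sum telescopes; [y] is the state at which the path is stopped. *)
Lemma transform_below p k x l :
  vnorm x <= rad k -> bounded_path (S k) l ->
  exists y, vnorm y <= 2 /\ transform (below p) k x l = vsub X y x.
Proof.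
  revert k x; induction l as [|u l IH]; simpl; intros k x Hx Hl.
  - exists x. split; [specialize (rad_2 k); lra|]. vec.
  - destruct Hl as [Hu Hl]. destruct (IH (S k) u Hu Hl) as (y & Hy & E).
    destruct (Nat.lt_ge_cases k p) as [H|H].
    + exists y. split; [easy|]. rewrite E, below_1 by easy. vec.
    + exists x. split; [specialize (rad_2 k); lra|].
      rewrite below_0, transform_0 by (auto; intros; apply below_0; lia). vec.
Qed.

Lemma transform_wave s w k x l :
  s = 1 \/ s = -1 -> vnorm x <= rad k -> bounded_path (S k) l ->
  vnorm (transform (wave s w) k x l) <= 4 * INR (length w).
Proof.
  intros Hs Hx Hl. revert s Hs.
  induction w as [|a|p q w IH] using list_pair_ind; intros s Hs.
  - rewrite transform_0, vnorm_zero by easy. simpl. lra.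
  - rewrite transform_0, vnorm_zero by easy. simpl. lra.
  - rewrite (transform_ext _
      (fun j => 1 * (s * below q j + (- s) * below p j) + 1 * wave (- s) w j))
      by (intros; simpl; ring).
    rewrite transform_lin, transform_lin.
    destruct (transform_below p k x l) as (y & Hy & ->); auto.
    destruct (transform_below q k x l) as (y' & Hy' & ->); auto.
    assert (IHs : vnorm (transform (wave (- s) w) k x l) <= 4 * INR (length w))
      by (apply IH; lra).
    set (z := transform (wave (- s) w) k x l) in *.
    eapply Rle_trans;
      [apply (vnorm_le_add (vscal s (vsub X y' y)) z); vec|].
    rewrite vnorm_scal.
    replace (Rabs s) with 1
      by (destruct Hs as [-> | ->]; [rewrite Rabs_R1 | rewrite Rabs_left]; lra).
    pose proof (vnorm_le_sub y' y _ eq_refl).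
    simpl length. rewrite !S_INR. lra.
Qed.

Variables (x0 : X) (kappa : R).
Hypothesis x0_rad : vnorm x0 <= rad 0.
Hypothesis kappa_range : 0 < kappa < 4.
Hypothesis parallelogram : forall x y : X,
  vnorm (vadd x y) ^ 2 + vnorm (vsub X x y) ^ 2
  <= (4 - kappa) * (vnorm x ^ 2 + vnorm y ^ 2).

Lemma bush_contradiction : False.
Proof.
  (* The parallelogram bound at half scale gives the ratio [1 - kappa / 4]; the lower and upper
     constants are the squares of [th / 2] and of the 4 in [transform_wave]. *)
  apply (james_contradiction
    (fun N A => EP N 0 x0 (fun l => vnorm (transform A 0 x0 l) ^ 2))
    (1 - kappa / 4) ((th / 2) ^ 2) 16).
  - lra.
  - apply pow_lt. lra.
  - intros N A B.
    match goal with |- ?a + ?b <= ?c * (?d + ?e) =>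
      replace (a + b) with (1 * a + 1 * b) by ring;
      replace (c * (d + e)) with (c * d + c * e) by ring end.
    rewrite <- !EP_lin. apply EP_le. intros l.
    rewrite (transform_ext (fun k => (A k + B k) / 2)
      (fun k => / 2 * A k + / 2 * B k)) by (intros; field).
    rewrite (transform_ext (fun k => (B k - A k) / 2)
      (fun k => / 2 * B k + (- / 2) * A k)) by (intros; field).
    rewrite !transform_lin.
    set (a := transform A 0 x0 l). set (b := transform B 0 x0 l).
    replace (vadd (vscal (/ 2) a) (vscal (/ 2) b)) with (vscal (/ 2) (vadd a b))
      by vec.
    replace (vadd (vscal (/ 2) b) (vscal (- / 2) a))
      with (vscal (/ 2) (vsub X b a)) by vec.
    rewrite !vnorm_scal_pos by lra.
    rewrite (vnorm_sub_sym b a). specialize (parallelogram a b). lra.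
  - intros N M A H HNM. replace M with (N + (M - N))%nat by lia.
    apply (EP_pad N (M - N) 0 x0 (fun y => vnorm y ^ 2)). auto.
  - intros N A j Hj HA.
    pose proof (EP_transform_lower N 0 x0 A vzero j) as H.
    rewrite (EP_ext _ _ _ _ (fun l => vnorm (transform A 0 x0 l))) in H
      by (intros; f_equal; vec).
    (* Expanding a square around [th / 2] gives E Z^2 >= th E Z - (th / 2)^2, in place of the
       Cauchy-Schwarz inequality. *)
    apply Rle_trans with
      (th * EP N 0 x0 (fun l => vnorm (transform A 0 x0 l))
       + - (th / 2) ^ 2 * EP N 0 x0 (fun _ => 1)).
    + rewrite EP_const. assert (th / 2 <= EP N 0 x0
        (fun l => vnorm (transform A 0 x0 l))) by (apply H; auto; lia). nra.
    + rewrite <- EP_lin. apply EP_le. intros l.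
      pose proof (pow2_ge_0 (vnorm (transform A 0 x0 l) - th / 2)). nra.
  - intros N l. rewrite <- (EP_const N 0 x0 (16 * INR (length l) ^ 2)).
    apply EP_le_bounded; [easy|]. intros l' Hl'.
    replace (16 * INR (length l) ^ 2) with ((4 * INR (length l)) ^ 2) by ring.
    apply pow_incr. split; [apply vnorm_ge0|]. apply transform_wave; auto.
Qed.

End Bush.

(** * Functionals and isometries *)

Section Functionals.
Context {X : Banach}.
Implicit Types (x y u : X) (f : X -> R) (T : X -> X).

Lemma dual_sub f x y : dual_elt X f -> f (vsub X x y) = f x - f y.
Proof.
  intros (Hadd & Hscal & _). unfold vsub.
  rewrite Hadd, vopp_scal, Hscal. ring.
Qed.

Lemma dual_half f x y : dual_elt X f -> f (vscal (1/2) (vadd x y)) = (f x + f y) / 2.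
Proof. intros (Hadd & Hscal & _). rewrite Hscal, Hadd. field. Qed.

Lemma dual_le_norm f x : dual_sphere X f -> f x <= vnorm x.
Proof.
  intros [(Hadd & Hscal & C & HC) [Hub _]].
  destruct (vnorm_ge0 x) as [H|H].
  - assert (Hb : Rabs (f (vscal (/ vnorm x) x)) <= 1).
    { apply Hub. exists (vscal (/ vnorm x) x). split; [|easy].
      unfold ball. rewrite vnorm_normalize by easy. lra. }
    rewrite Hscal in Hb. pose proof (Rle_abs (/ vnorm x * f x)).
    apply (Rmult_le_reg_l (/ vnorm x)); [now apply Rinv_0_lt_compat|].
    rewrite Rinv_l; lra.
  - specialize (HC x). rewrite <- H in *. pose proof (Rle_abs (f x)). lra.
Qed.

Lemma isom_sub T x y : isom_aut X T -> T (vsub X x y) = vsub X (T x) (T y).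
Proof.
  intros (Hadd & Hscal & _). unfold vsub. rewrite Hadd, !vopp_scal, Hscal.
  reflexivity.
Qed.

Lemma isom_half T x y : isom_aut X T ->
  T (vscal (1/2) (vadd x y)) = vscal (1/2) (vadd (T x) (T y)).
Proof. intros (Hadd & Hscal & _). now rewrite Hscal, Hadd. Qed.

Lemma isom_comp T T' : isom_aut X T -> isom_aut X T' ->
  isom_aut X (fun x => T (T' x)).
Proof.
  intros (A1 & S1 & N1 & O1) (A2 & S2 & N2 & O2). repeat split; intros.
  - now rewrite A2, A1.
  - now rewrite S2, S1.
  - now rewrite N1, N2.
  - destruct (O1 y) as [z Hz]. destruct (O2 z) as [w Hw]. exists w. now subst.
Qed.

Lemma isom_inj T x y : isom_aut X T -> T x = T y -> x = y.
Proof.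
  intros HT E. assert (H : vnorm (vsub X x y) = 0).
  { rewrite <- (proj1 (proj2 (proj2 HT)) (vsub X x y)), isom_sub, E by easy.
    now rewrite vsub_self, vnorm_zero. }
  apply vnorm_eq0 in H.
  rewrite <- (vadd_0 _ y), <- H. vec.
Qed.

Lemma isom_inverse T : isom_aut X T ->
  exists T', isom_aut X T' /\ forall x, T (T' x) = x.
Proof.
  intros HT. pose proof HT as (Ha & Hs & Hn & Ho).
  set (T' := fun y => proj1_sig (constructive_indefinite_description _ (Ho y))).
  assert (H : forall y, T (T' y) = y) by
    (intros y; apply (proj2_sig (constructive_indefinite_description _ (Ho y)))).
  exists T'. split; [|easy]. repeat split; intros.
  - apply (isom_inj T); auto. now rewrite Ha, !H.
  - apply (isom_inj T); auto. now rewrite Hs, !H.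
  - now rewrite <- Hn, H.
  - exists (T y). apply (isom_inj T); auto.
Qed.

Lemma dual_comb f L : dual_elt X f -> f (comb X L) = avg L f.
Proof.
  intros (Ha & Hs & _). induction L as [|p L IH]; simpl.
  - rewrite <- (vscal_0 vzero), Hs. ring.
  - now rewrite Ha, Hs, IH.
Qed.

(** Otherwise [f] is at most [1 - e] on the orbit and its convex hull, hence at most [1 - e / 2] on
    the ball, against its norm being 1. *)
Lemma ct_orbit_norming f x e :
  convex_transitive X -> dual_sphere X f -> sphere X x -> e > 0 ->
  exists T, isom_aut X T /\ f (T x) > 1 - e.
Proof.
  intros CT Hf Hx He. pose proof Hf as [Hd [_ Hlub]].
  apply NNPP. intros Hno.
  assert (Hall : forall y, conv X (orbit X x) y -> f y <= 1 - e).
  { intros y (L & HL & H1 & ->). rewrite dual_comb by easy.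
    rewrite <- (Rmult_1_l (1 - e)), <- H1, <- avg_const.
    rewrite Forall_forall in HL.
    apply avg_le; [intros p Hp; now apply HL|].
    intros p Hp. destruct (proj2 (HL p Hp)) as (T & HT & ->).
    apply Rnot_lt_le. intros H. apply Hno. exists T. split; [easy|lra]. }
  assert (Hb : forall b, ball X b -> f b <= 1 - e / 2).
  { intros b Hb. destruct (proj2 (CT x Hx b) Hb (e / 2)) as (a & Ha & Hba); [lra|].
    apply Hall in Ha. pose proof (dual_le_norm f (vsub X b a) Hf) as H.
    rewrite dual_sub in H by easy. lra. }
  assert (1 <= 1 - e / 2); [|lra].
  apply Hlub. intros s (b & Hbb & ->). unfold Rabs. destruct (Rcase_abs (f b)).
  - replace (- f b) with (f (vscal (-1) b))
      by (rewrite (proj1 (proj2 Hd)); ring).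
    apply Hb. unfold ball in *. now rewrite <- vopp_scal, vnorm_opp.
  - now apply Hb.
Qed.

End Functionals.

(** * Uniform nonsquareness implies uniform convexity *)

Definition nonsquare (X : Banach) : Prop :=
  exists eta, 0 < eta < 1 /\ forall x y : X, ball X x -> ball X y ->
    vnorm (vadd x y) <= 2 - eta \/ vnorm (vsub X x y) <= 2 - eta.

(** Let a >= b be the two norms. If b <= (1 - eta / 8) a, the term (a - b)^2 lost in the triangle
    inequality suffices; otherwise b is close to a, and nonsquareness, rescaled by a, improves one
    of the two squares. *)
Lemma nonsquare_parallelogram X : nonsquare X ->
  exists kappa, 0 < kappa < 4 /\ forall x y : X,
    vnorm (vadd x y) ^ 2 + vnorm (vsub X x y) ^ 2
    <= (4 - kappa) * (vnorm x ^ 2 + vnorm y ^ 2).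
Proof.
  intros (eta & He & H). exists (eta ^ 2 / 64). split; [nra|].
  assert (W : forall x y : X, vnorm y <= vnorm x ->
    vnorm (vadd x y) ^ 2 + vnorm (vsub X x y) ^ 2
    <= (4 - eta ^ 2 / 64) * (vnorm x ^ 2 + vnorm y ^ 2)).
  { intros x y Hxy.
    pose proof (vnorm_le_add x y _ eq_refl) as HP.
    pose proof (vnorm_le_sub x y _ eq_refl) as HM.
    pose proof (vnorm_ge0 (vadd x y)). pose proof (vnorm_ge0 (vsub X x y)).
    pose proof (vnorm_ge0 x) as Ha. pose proof (vnorm_ge0 y) as Hb.
    assert (G : vnorm (vadd x y) <= (2 - eta) * vnorm x \/
                vnorm (vsub X x y) <= (2 - eta) * vnorm x).
    { destruct Ha as [Ha|Ha]; [|left; rewrite <- Ha in *; nra].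
      assert (Hi : 0 < / vnorm x) by now apply Rinv_0_lt_compat.
      assert (Hii : / vnorm x * vnorm x = 1) by (apply Rinv_l; lra).
      destruct (H (vscal (/ vnorm x) x) (vscal (/ vnorm x) y)) as [G|G].
      - unfold ball. rewrite vnorm_normalize by easy. lra.
      - unfold ball. rewrite vnorm_scal_pos by lra.
        rewrite <- Hii. apply Rmult_le_compat_l; lra.
      - left. rewrite <- vscal_addr, vnorm_scal_pos in G by lra.
        apply (Rmult_le_reg_l (/ vnorm x)); [easy|].
        replace (/ vnorm x * ((2 - eta) * vnorm x)) with (2 - eta); [easy|].
        transitivity ((2 - eta) * (/ vnorm x * vnorm x)); [rewrite Hii|]; ring.
      - right. replace (vsub _ _ _) with (vscal (/ vnorm x) (vsub X x y)) in G
          by vec.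
        rewrite vnorm_scal_pos in G by lra.
        apply (Rmult_le_reg_l (/ vnorm x)); [easy|].
        replace (/ vnorm x * ((2 - eta) * vnorm x)) with (2 - eta); [easy|].
        transitivity ((2 - eta) * (/ vnorm x * vnorm x)); [rewrite Hii|]; ring. }
    set (a := vnorm x) in *. set (b := vnorm y) in *.
    set (P := vnorm (vadd x y)) in *. set (M := vnorm (vsub X x y)) in *.
    assert (HP2 : P ^ 2 <= (a + b) ^ 2) by (apply pow_incr; lra).
    assert (HM2 : M ^ 2 <= (a + b) ^ 2) by (apply pow_incr; lra).
    destruct (Rle_dec b ((1 - eta / 8) * a)) as [Hba|Hba].
    - assert ((eta / 8 * a) ^ 2 <= (a - b) ^ 2).
      { apply pow_incr. split; [|lra]. apply Rmult_le_pos; lra. }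
      assert (eta ^ 2 * b ^ 2 <= eta ^ 2 * a ^ 2).
      { apply Rmult_le_compat_l; [apply pow2_ge_0|]. apply pow_incr. lra. }
      lra.
    - assert (E : P ^ 2 + M ^ 2 <= (8 - 3 * eta) * a ^ 2).
      { assert (Hs : (a + b) ^ 2 <= 4 * a ^ 2).
        { replace (4 * a ^ 2) with ((2 * a) ^ 2) by ring. apply pow_incr. lra. }
        assert (Ht : ((2 - eta) * a) ^ 2 <= (4 - 3 * eta) * a ^ 2).
        { rewrite Rpow_mult_distr. apply Rmult_le_compat_r; [apply pow2_ge_0|nra]. }
        destruct G as [G|G].
        - assert (P ^ 2 <= ((2 - eta) * a) ^ 2) by (apply pow_incr; lra). lra.
        - assert (M ^ 2 <= ((2 - eta) * a) ^ 2) by (apply pow_incr; lra). lra. }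
      assert (Hb2 : ((1 - eta / 8) * a) ^ 2 <= b ^ 2).
      { apply pow_incr. split; [|lra]. apply Rmult_le_pos; lra. }
      rewrite Rpow_mult_distr in Hb2.
      apply Rle_trans with
        ((4 - eta ^ 2 / 64) * ((1 + (1 - eta / 8) ^ 2) * a ^ 2)).
      + rewrite <- Rmult_assoc. eapply Rle_trans; [exact E|].
        apply Rmult_le_compat_r; [apply pow2_ge_0|].
        assert (0 <= eta ^ 2 <= eta) by nra. nra.
      + apply Rmult_le_compat_l; nra. }
  intros x y. destruct (Rle_dec (vnorm y) (vnorm x)) as [L|L]; [now apply W|].
  rewrite (vadd_comm _ x y), (vnorm_sub_sym x y), (Rplus_comm (vnorm x ^ 2)).
  apply W. lra.
Qed.

Lemma comb_rescale_pair {X : Banach} (g1 g2 : X -> X) a w L :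
  (forall p, In p L ->
     vscal (1/2) (vadd (g1 (snd p)) (g2 (snd p))) = vadd (vscal a (snd p)) w) ->
  vadd (comb X (rescale (1/2) g1 L)) (comb X (rescale (1/2) g2 L))
  = vadd (vscal a (comb X L)) (vscal (wsum X L) w).
Proof.
  induction L as [|p L IH]; simpl; intros H; [vec|].
  transitivity (vadd (vscal (fst p) (vscal (1/2) (vadd (g1 (snd p)) (g2 (snd p)))))
    (vadd (comb X (rescale (1/2) g1 L)) (comb X (rescale (1/2) g2 L)))); [vec|].
  rewrite IH, H by auto. vec.
Qed.

(* If (x1 + x2) / 2 has norm almost 1, then by convex transitivity every point
   is nearly a convex combination of points T ((x1 + x2) / 2); splitting each of
   them into T x1 and T x2 spreads the mass. *)
Lemma ct_children (X : Banach) eps :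
  convex_transitive X -> 0 < eps ->
  (forall delta, delta > 0 -> exists x y, ball X x /\ ball X y /\
     vnorm (vsub X x y) >= eps /\ vnorm (vscal (1/2) (vadd x y)) > 1 - delta) ->
  forall (x : X) e, 0 < e -> exists L,
    nonneg_weights L /\ wsum X L = 1 /\ comb X L = x /\
    (forall p, In p L -> vnorm (snd p) <= Rmax (vnorm x) 1 + e) /\
    eps / 2 <= avg L (fun u => vnorm (vsub X u x)).
Proof.
  intros CT Heps Hpair x e He.
  set (r := Rmax (vnorm x) 1).
  assert (Hr1 : 1 <= r) by apply Rmax_r.
  assert (Hrx : vnorm x <= r) by apply Rmax_l.
  assert (Hir : 0 < / r) by (apply Rinv_0_lt_compat; lra).
  assert (Hir1 : / r * r = 1) by (apply Rinv_l; lra).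
  (* This makes [r * d] at most [e / 4] and keeps the midpoint [m] away from zero. *)
  set (d := Rmin (e * / r / 4) (1/2)).
  assert (Hd : 0 < d).
  { apply Rmin_glb_lt; [|lra].
    assert (0 < e * / r) by now apply Rmult_lt_0_compat. lra. }
  assert (Hd2 : d <= 1/2) by apply Rmin_r.
  assert (Hdr : r * d <= e / 4).
  { apply Rle_trans with (r * (e * / r / 4)).
    - apply Rmult_le_compat_l; [lra|apply Rmin_l].
    - right. transitivity (e / 4 * (/ r * r)); [field; lra|rewrite Hir1; ring]. }
  destruct (Hpair d Hd) as (x1 & x2 & Hx1 & Hx2 & H12 & Hm).
  set (m := vscal (1/2) (vadd x1 x2)) in *.
  assert (Hm1 : vnorm m <= 1).
  { unfold m. rewrite vnorm_scal_pos by lra.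
    pose proof (vnorm_triangle _ x1 x2). unfold ball in *. lra. }
  assert (Hm0 : 0 < vnorm m) by lra.
  set (mh := vscal (/ vnorm m) m).
  assert (Hmh : sphere X mh) by now apply vnorm_normalize.
  set (b := vscal (/ r) x).
  assert (Hb : ball X b).
  { unfold ball, b. rewrite vnorm_scal_pos, <- Hir1 by lra.
    apply Rmult_le_compat_l; lra. }
  destruct (proj2 (CT mh Hmh b) Hb d Hd) as (a & (L & HL & HL1 & ->) & Hba).
  rewrite Forall_forall in HL.
  set (a := comb X L) in *.
  assert (Ha : vnorm a <= 2).
  { pose proof (vnorm_le_sub b (vsub X b a) a) as H. unfold ball in Hb.
    assert (a = vsub X b (vsub X b a)) by vec. specialize (H H0). lra. }
  (* The error [w], added to every child, makes the barycentre exactly [x]. *)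
  set (w := vsub X x (vscal (r * vnorm m) a)).
  assert (Hw : vnorm w <= 3 * e / 4).
  { assert (E : w = vadd (vscal r (vsub X b a)) (vscal (r * (1 - vnorm m)) a)).
    { unfold w, b. transitivity
        (vsub X (vscal (/ r * r) x) (vscal (r * vnorm m) a));
        [rewrite Hir1|]; vec. }
    rewrite E. eapply Rle_trans; [apply vnorm_triangle|].
    assert (0 <= r * (1 - vnorm m)) by (apply Rmult_le_pos; lra).
    rewrite !vnorm_scal_pos by lra.
    assert (r * vnorm (vsub X b a) <= r * d) by (apply Rmult_le_compat_l; lra).
    assert (r * (1 - vnorm m) * vnorm a <= r * d * 2).
    { apply Rmult_le_compat; [nra|apply vnorm_ge0| |easy].
      apply Rmult_le_compat_l; lra. }
    lra. }
  (* An isometry is chosen for each orbit point; the identity is a dummy value off the orbit. *)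
  destruct (choice (fun u T => orbit X mh u -> isom_aut X T /\ u = T mh))
    as [tau Htau].
  { intros u. destruct (classic (orbit X mh u)) as [(T & HT)|H].
    - now exists T.
    - exists (fun y => y). easy. }
  set (g := fun x u => vadd (vscal r (tau u x)) w).
  assert (Hg : forall z p, In p L -> ball X z ->
                 vnorm (g z (snd p)) <= r + e).
  { intros z p Hp Hz. destruct (Htau _ (proj2 (HL p Hp))) as [HT _].
    unfold g. eapply Rle_trans; [apply vnorm_triangle|].
    rewrite vnorm_scal_pos, (proj1 (proj2 (proj2 HT))) by lra.
    unfold ball in Hz. nra. }
  exists (rescale (1/2) (g x1) L ++ rescale (1/2) (g x2) L).
  split; [|split; [|split; [|split]]].
  - intros p Hp. unfold rescale in Hp.
    apply in_app_or in Hp as [Hp|Hp]; apply in_map_iff in Hp as (p' & <- & Hp);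
      simpl; destruct (HL _ Hp); lra.
  - rewrite wsum_app, !wsum_rescale, HL1. lra.
  - rewrite comb_app, (comb_rescale_pair _ _ (r * vnorm m) w), HL1.
    + unfold w. fold a. vec.
    + intros p Hp. destruct (Htau _ (proj2 (HL p Hp))) as [HT Hu].
      transitivity (vadd (vscal r (tau (snd p) m)) w).
      * unfold m, g. rewrite isom_half by easy. vec.
      * rewrite Hu at 2. unfold mh. rewrite (proj1 (proj2 HT)).
        f_equal. generalize (tau (snd p) m). intros z. vec.
  - intros p Hp. unfold rescale in Hp.
    apply in_app_or in Hp as [Hp|Hp]; apply in_map_iff in Hp as (p' & <- & Hp);
      simpl; apply Hg; auto.
  - rewrite avg_app, !avg_rescale, <- avg_lin.
    rewrite <- (Rmult_1_l (eps / 2)), <- HL1, <- avg_const.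
    apply avg_le; [intros p Hp; now apply HL|]. intros p Hp.
    destruct (Htau _ (proj2 (HL p Hp))) as [HT _].
    (* The two children differ by [r] times an isometric image of [x1 - x2], so their distances to
       [x] add up to at least [eps]. *)
    pose proof (vnorm_le_sub (vsub X (g x1 (snd p)) x) (vsub X (g x2 (snd p)) x)
      (vscal r (tau (snd p) (vsub X x1 x2)))) as H.
    rewrite vnorm_scal_pos, (proj1 (proj2 (proj2 HT))) in H by lra.
    rewrite isom_sub in H by easy.
    assert (Hrr : vnorm (vsub X x1 x2) <= r * vnorm (vsub X x1 x2))
      by (pose proof (vnorm_ge0 (vsub X x1 x2)); nra).
    assert (H' := H ltac:(unfold g; vec)). cbv beta. rewrite HL1. lra.
Qed.

Lemma nonsquare_uniformly_convex (X : Banach) :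
  convex_transitive X -> nonsquare X -> uniformly_convex X.
Proof.
  intros CT NS eps Heps. apply NNPP. intros Hno.
  assert (Hpair : forall delta, delta > 0 -> exists x y, ball X x /\ ball X y /\
     vnorm (vsub X x y) >= eps /\ vnorm (vscal (1/2) (vadd x y)) > 1 - delta).
  { intros delta Hd. apply NNPP. intros H. apply Hno. exists delta.
    split; [easy|]. intros x y Hx Hy Hxy. apply Rnot_lt_le. intros L.
    apply H. now exists x, y. }
  destruct (nonsquare_parallelogram X NS) as (kappa & Hk & Hpar).
  pose proof (ct_children X eps CT (proj1 Heps) Hpair) as Hch.
  assert (Hpow : forall k, 0 < (1/2) ^ k) by (intros; apply pow_lt; lra).
  destruct (choice (fun (kx : nat * X) L =>
    nonneg_weights L /\ wsum X L = 1 /\ comb X L = snd kx /\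
    (forall p, In p L ->
       vnorm (snd p) <= Rmax (vnorm (snd kx)) 1 + (1/2) ^ S (fst kx)) /\
    eps / 2 <= avg L (fun u => vnorm (vsub X u (snd kx))))) as [ch H].
  { intros [k x]. apply Hch, Hpow. }
  (* The error allowed at time [k] is (1/2)^(k+1), which is exactly the growth of the radius 2 -
     (1/2)^k. *)
  apply (bush_contradiction (fun k x => ch (k, x)) (fun k => 2 - (1/2) ^ k)
           (eps / 2)) with (x0 := vzero) (kappa := kappa); try easy;
    try (intros k x; now destruct (H (k, x)) as (? & ? & ? & ? & ?)).
  - intros k x Hx p Hp.
    destruct (H (k, x)) as (_ & _ & _ & Hb & _). specialize (Hb p Hp).
    cbn [fst snd] in Hb.
    assert (Hk1 : (1/2) ^ k <= 1).
    { apply Rle_trans with (1 ^ k); [apply pow_incr; lra|rewrite pow1; lra]. }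
    assert (Rmax (vnorm x) 1 <= 2 - (1/2) ^ k) by (apply Rmax_lub; lra).
    simpl in *. lra.
  - intros k. specialize (Hpow k). simpl. lra.
  - lra.
  - rewrite vnorm_zero. simpl. lra.
Qed.

(** * Uniform smoothness *)

Section RoughWalk.
Context {X : Banach}.
Variables (step : X -> X) (c : R).
Hypothesis c_pos : 0 < c.
Hypothesis step_norm : forall x, vnorm (step x) = 1.
Hypothesis step_rough : forall x,
  2 * vnorm x + 2 * c <= vnorm (vadd x (step x)) + vnorm (vsub X x (step x)).

Implicit Types (x z : X) (phi psi : X -> R).

(** Expectation of [phi] after [n] steps with fair random signs; the direction of each step depends
    on the current position. *)
Fixpoint walk (n : nat) phi x : R :=
  match n with
  | O => phi x
  | S n => (walk n phi (vadd x (step x)) + walk n phi (vsub X x (step x))) / 2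
  end.

Lemma walk_add m n phi x : walk (m + n) phi x = walk m (walk n phi) x.
Proof. revert x; induction m as [|m IH]; simpl; intros x; [easy|]. now rewrite !IH. Qed.

Lemma walk_le n phi psi x :
  (forall z, vnorm (vsub X z x) <= INR n -> phi z <= psi z) ->
  walk n phi x <= walk n psi x.
Proof.
  revert x; induction n as [|n IH]; intros x H.
  - apply H. rewrite vsub_self, vnorm_zero. simpl. lra.
  - rewrite S_INR in H. simpl.
    assert (walk n phi (vadd x (step x)) <= walk n psi (vadd x (step x))).
    { apply IH. intros z Hz. apply H.
      pose proof (vnorm_le_add (vsub X z (vadd x (step x))) (step x) (vsub X z x)
        ltac:(vec)). rewrite step_norm in *. lra. }
    assert (walk n phi (vsub X x (step x)) <= walk n psi (vsub X x (step x))).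
    { apply IH. intros z Hz. apply H.
      pose proof (vnorm_le_sub (vsub X z (vsub X x (step x))) (step x) (vsub X z x)
        ltac:(vec)). rewrite step_norm in *. lra. }
    lra.
Qed.

Lemma walk_lin n a b d phi psi x :
  walk n (fun z => a * phi z + b * psi z + d) x
  = a * walk n phi x + b * walk n psi x + d.
Proof. revert x; induction n as [|n IH]; simpl; intros x; [easy|]. rewrite !IH. field. Qed.

Lemma walk_dist_ge n a x :
  vnorm (vsub X x a) <= walk n (fun z => vnorm (vsub X z a)) x.
Proof.
  revert x; induction n as [|n IH]; simpl; intros x; [lra|].
  pose proof (IH (vadd x (step x))). pose proof (IH (vsub X x (step x))).
  pose proof (vnorm_le_add (vsub X (vadd x (step x)) a)
    (vsub X (vsub X x (step x)) a) (vscal 2 (vsub X x a)) ltac:(vec)) as G.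
  rewrite vnorm_scal_pos in G by lra. lra.
Qed.

Lemma walk_norm_growth n x : vnorm x + c * INR n <= walk n vnorm x.
Proof.
  revert x; induction n as [|n IH]; intros x; [simpl; lra|].
  rewrite S_INR. simpl.
  pose proof (IH (vadd x (step x))). pose proof (IH (vsub X x (step x))).
  specialize (step_rough x). lra.
Qed.

(** Roughness gains [c] in mean norm at each step, and the triangle inequality turns this into
    displacement. *)
Lemma walk_dist_growth n x :
  c * INR n <= walk n (fun z => vnorm (vsub X z x)) x.
Proof.
  pose proof (walk_norm_growth n x).
  assert (walk n vnorm x
          <= walk n (fun z => 1 * vnorm (vsub X z x) + 0 * 0 + vnorm x) x).
  { apply walk_le. intros z _.
    pose proof (vnorm_le_add (vsub X z x) x z ltac:(vec)). lra. }
  rewrite (walk_lin n 1 0 (vnorm x) _ (fun _ => 0)) in H0. lra.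
Qed.

Variable kappa : R.
Hypothesis kappa_pos : 0 < kappa.
Hypothesis midpoint : forall u v : X, vnorm u <= 1 -> vnorm v <= 1 ->
  vnorm (vadd u v) ^ 2
  <= 2 * vnorm u ^ 2 + 2 * vnorm v ^ 2 - kappa * (vnorm (vsub X u v) - c / 2).

Lemma midpoint_scaled t (u v : X) : 0 < t -> vnorm u <= t -> vnorm v <= t ->
  vnorm (vadd u v) ^ 2
  <= 2 * vnorm u ^ 2 + 2 * vnorm v ^ 2
     - kappa * t * (vnorm (vsub X u v) - c * t / 2).
Proof.
  intros Ht Hu Hv.
  assert (Hi : 0 < / t) by now apply Rinv_0_lt_compat.
  assert (Hit : t * / t = 1) by (apply Rinv_r; lra).
  assert (N : forall w : X, vnorm w = t * vnorm (vscal (/ t) w)).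
  { intros w. rewrite vnorm_scal_pos by lra. rewrite <- Rmult_assoc, Hit. ring. }
  assert (B : forall w : X, vnorm w <= t -> vnorm (vscal (/ t) w) <= 1).
  { intros w Hw. rewrite vnorm_scal_pos, <- Hit, (Rmult_comm t) by lra.
    apply Rmult_le_compat_l; lra. }
  pose proof (midpoint _ _ (B u Hu) (B v Hv)) as M.
  rewrite (N u), (N v), (N (vadd u v)), (N (vsub X u v)).
  replace (vscal (/ t) (vadd u v)) with (vadd (vscal (/ t) u) (vscal (/ t) v))
    by vec.
  replace (vscal (/ t) (vsub X u v)) with (vsub X (vscal (/ t) u) (vscal (/ t) v))
    by vec.
  apply (Rmult_le_compat_l (t ^ 2)) in M; [|apply pow2_ge_0]. lra.
Qed.

(* The two halves of a walk of length [2 * m] are increments of norm at most [m]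
   which are [c * m] apart on average, so the midpoint inequality gains at each
   doubling. *)
Lemma walk_square n x :
  walk (2 ^ n) (fun z => vnorm (vsub X z x) ^ 2) x
  <= INR (2 ^ n) ^ 2 * (1 - INR n * (kappa * c / 8)).
Proof.
  revert x; induction n as [|n IH]; intros x.
  - simpl. pose proof (step_norm x) as H.
    replace (vsub X (vadd x (step x)) x) with (step x) by vec.
    replace (vsub X (vsub X x (step x)) x) with (vopp (step x)) by vec.
    rewrite vnorm_opp, H. lra.
  - set (m := (2 ^ n)%nat) in *.
    set (E := INR m ^ 2 * (1 - INR n * (kappa * c / 8))) in *.
    replace (2 ^ S n)%nat with (m + m)%nat by (simpl; unfold m; lia).
    assert (Hm : 0 < INR m).
    { apply lt_0_INR. unfold m. pose proof (Nat.pow_nonzero 2 n). lia. }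
    rewrite walk_add.
    set (k := kappa * INR m).
    assert (Hk : 0 < k) by now apply Rmult_lt_0_compat.
    eapply Rle_trans; [apply (walk_le _ _ (fun z =>
      2 * vnorm (vsub X z x) ^ 2 + (- k) * vnorm (vsub X z x)
      + (2 * E + k * (c * INR m / 2))))|].
    + intros z Hz.
      eapply Rle_trans; [apply (walk_le _ _ (fun w =>
        2 * vnorm (vsub X w z) ^ 2
        + (- k) * vnorm (vsub X w (vsub X (vscal 2 z) x))
        + (2 * vnorm (vsub X z x) ^ 2 + k * (c * INR m / 2))))|].
      * intros w Hw.
        pose proof (midpoint_scaled (INR m) _ _ Hm Hw Hz) as M.
        replace (vadd (vsub X w z) (vsub X z x)) with (vsub X w x) in M by vec.
        replace (vsub X (vsub X w z) (vsub X z x))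
          with (vsub X w (vsub X (vscal 2 z) x)) in M by vec.
        unfold k. lra.
      * rewrite (walk_lin m 2 (- k) _ (fun w => vnorm (vsub X w z) ^ 2)
          (fun w => vnorm (vsub X w (vsub X (vscal 2 z) x)))).
        (* The increments of the two halves differ by [w - (2 z - x)]. Averaged over the second
           half, its norm is at least that of [z - x]. *)
        pose proof (walk_dist_ge m (vsub X (vscal 2 z) x) z) as H.
        replace (vsub X z (vsub X (vscal 2 z) x)) with (vopp (vsub X z x)) in H
          by vec.
        rewrite vnorm_opp in H.
        apply (Rmult_le_compat_l k) in H; [|lra]. specialize (IH z). lra.
    + rewrite (walk_lin m 2 (- k) _ (fun z => vnorm (vsub X z x) ^ 2)
        (fun z => vnorm (vsub X z x))).
      (* The mean displacement [c * INR m] is twice the threshold in the midpoint inequality; the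
         surplus yields the drop of [kappa * c / 8]. *)
      pose proof (walk_dist_growth m x) as H.
      apply (Rmult_le_compat_l k) in H; [|lra]. specialize (IH x).
      rewrite plus_INR, S_INR. unfold k, E in *. lra.
Qed.

(** After enough doublings the upper bound for a mean square is negative. *)
Lemma rough_walk_contradiction : False.
Proof.
  assert (Hd : 0 < kappa * c / 8) by nra.
  destruct (INR_archimed (kappa * c / 8) 1 Hd) as [n Hn].
  pose proof (walk_square n vzero) as H.
  assert (0 <= walk (2 ^ n) (fun z => vnorm (vsub X z vzero) ^ 2) vzero).
  { pose proof (walk_lin (2 ^ n) 0 0 0 (fun _ => 0) (fun _ => 0) vzero) as H0.
    rewrite !Rmult_0_l, !Rplus_0_l in H0. rewrite <- H0.
    apply walk_le. intros z _. pose proof (pow2_ge_0 (vnorm (vsub X z vzero))). lra. }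
  assert (0 < INR (2 ^ n) ^ 2).
  { apply pow_lt, lt_0_INR. pose proof (Nat.pow_nonzero 2 n). lia. }
  nra.
Qed.

End RoughWalk.

(** * From uniform convexity to uniform smoothness *)

(** A gain linear in the distance can be averaged along a walk. If the norms differ by [d * h / 4]
    or more, the square of their difference pays for it; otherwise uniform convexity, rescaled by
    the larger norm, does. *)
Lemma uniformly_convex_midpoint (X : Banach) h :
  uniformly_convex X -> 0 < h <= 2 ->
  exists kappa, 0 < kappa /\ forall u v : X, vnorm u <= 1 -> vnorm v <= 1 ->
    vnorm (vadd u v) ^ 2
    <= 2 * vnorm u ^ 2 + 2 * vnorm v ^ 2 - kappa * (vnorm (vsub X u v) - h).
Proof.
  intros UC Hh. destruct (UC h Hh) as (d0 & Hd0 & Hd).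
  set (d := Rmin d0 1).
  assert (Hd1 : 0 < d <= 1).
  { split; [apply Rmin_glb_lt; lra|apply Rmin_r]. }
  assert (Hdd : d <= d0) by apply Rmin_l.
  set (k := d ^ 2 * h ^ 2 / 32).
  assert (Hk : 0 < k).
  { assert (0 < d ^ 2 * h ^ 2) by (apply Rmult_lt_0_compat; apply pow_lt; lra).
    unfold k. lra. }
  exists k. split; [easy|].
  assert (W : forall u v : X, vnorm u <= 1 -> vnorm v <= vnorm u ->
    vnorm (vadd u v) ^ 2
    <= 2 * vnorm u ^ 2 + 2 * vnorm v ^ 2 - k * (vnorm (vsub X u v) - h)).
  { intros u v Hu Hv.
    pose proof (vnorm_le_add u v _ eq_refl) as HP.
    pose proof (vnorm_le_sub u v _ eq_refl) as HD.
    pose proof (vnorm_ge0 v) as Hq0. pose proof (vnorm_ge0 (vadd u v)) as HP0.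
    set (p := vnorm u) in *. set (q := vnorm v) in *.
    set (D := vnorm (vsub X u v)) in *. set (P := vnorm (vadd u v)) in *.
    assert (HP2 : P ^ 2 <= (p + q) ^ 2) by (apply pow_incr; lra).
    pose proof (pow2_ge_0 (p - q)).
    destruct (Rlt_le_dec D h) as [L|L].
    { assert (0 <= k * (h - D)) by (apply Rmult_le_pos; lra). lra. }
    assert (HkD : k * (D - h) <= 2 * k).
    { rewrite (Rmult_comm 2). apply Rmult_le_compat_l; lra. }
    assert (Hp : h / 2 <= p) by lra.
    destruct (Rle_dec (d * h / 4) (p - q)) as [T|T].
    { assert ((d * h / 4) ^ 2 <= (p - q) ^ 2).
      { apply pow_incr. split; [|easy].
        assert (0 <= d * h) by (apply Rmult_le_pos; lra). lra. }
      unfold k in *. lra. }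
    assert (Hi : 0 < / p) by (apply Rinv_0_lt_compat; lra).
    assert (Hip : p * / p = 1) by (apply Rinv_r; lra).
    assert (HPd : P <= 2 * (1 - d) * p).
    { assert (G : vnorm (vscal (1/2) (vadd (vscal (/ p) u) (vscal (/ p) v)))
                  <= 1 - d0).
      { apply Hd.
        - unfold ball. rewrite vnorm_scal_pos by lra. fold p. lra.
        - unfold ball. rewrite vnorm_scal_pos by lra. fold q.
          apply Rle_trans with (/ p * p); [apply Rmult_le_compat_l; lra|lra].
        - replace (vsub _ _ _) with (vscal (/ p) (vsub X u v)) by vec.
          rewrite vnorm_scal_pos by lra. fold D.
          apply Rle_ge. apply Rle_trans with D; [easy|].
          rewrite <- (Rmult_1_l D) at 1. apply Rmult_le_compat_r; [lra|].
          rewrite <- Hip. rewrite <- (Rmult_1_l (/ p)) at 2.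
          apply Rmult_le_compat_r; lra. }
      rewrite <- vscal_addr, vscal_assoc, vnorm_scal_pos in G by lra.
      fold P in G. apply (Rmult_le_compat_l (2 * p)) in G; [|lra].
      replace (2 * p * (1 / 2 * / p * P)) with (p * / p * P) in G
        by (field; lra).
      rewrite Hip in G.
      assert (d * p <= d0 * p) by (apply Rmult_le_compat_r; lra). lra. }
    assert (HPp : P ^ 2 <= 4 * (1 - d) * p ^ 2).
    { apply Rle_trans with ((2 * (1 - d) * p) ^ 2); [apply pow_incr; lra|].
      replace ((2 * (1 - d) * p) ^ 2) with (4 * p ^ 2 * (1 - d) ^ 2) by ring.
      replace (4 * (1 - d) * p ^ 2) with (4 * p ^ 2 * (1 - d)) by ring.
      apply Rmult_le_compat_l; [|nra]. pose proof (pow2_ge_0 p). lra. }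
    assert (Hq : p ^ 2 - 2 * p * (d * h / 4) <= q ^ 2).
    { assert ((p - q) * (p + q) <= d * h / 4 * (2 * p)); [|lra].
      apply Rmult_le_compat; lra. }
    assert (Hpd : d * h / 4 <= d * p - d * h / 4) by nra.
    assert (h / 2 * (d * h / 4) <= p * (d * p - d * h / 4)).
    { apply Rmult_le_compat; nra. }
    assert (d ^ 2 * h ^ 2 <= d * h ^ 2).
    { apply Rmult_le_compat_r; [apply pow2_ge_0|nra]. }
    assert (0 <= d * h ^ 2) by (apply Rmult_le_pos; [lra|apply pow2_ge_0]).
    unfold k in *. lra. }
  intros u v Hu Hv. destruct (Rle_dec (vnorm v) (vnorm u)) as [L|L]; [now apply W|].
  rewrite (vadd_comm _ u v), (vnorm_sub_sym u v), (Rplus_comm (2 * vnorm u ^ 2)).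
  apply W; lra.
Qed.

(** By convexity of the norm, since x + s y lies between x and x + t y; the monotone difference
    quotient is stated without division. *)
Lemma symmetric_growth_mono {X : Banach} (x y : X) s t :
  vnorm x = 1 -> 0 < s <= t ->
  t * (vnorm (vadd x (vscal s y)) + vnorm (vsub X x (vscal s y)) - 2)
  <= s * (vnorm (vadd x (vscal t y)) + vnorm (vsub X x (vscal t y)) - 2).
Proof.
  intros Hx Hst.
  pose proof (vnorm_le_add (vscal s (vadd x (vscal t y))) (vscal (t - s) x)
    (vscal t (vadd x (vscal s y))) ltac:(vec)) as H1.
  pose proof (vnorm_le_add (vscal s (vsub X x (vscal t y))) (vscal (t - s) x)
    (vscal t (vsub X x (vscal s y))) ltac:(vec)) as H2.
  rewrite !vnorm_scal_pos in H1, H2 by lra. rewrite Hx in *. lra.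
Qed.

Lemma uniformly_smooth_of_convex (X : Banach) :
  almost_transitive X -> uniformly_convex X -> uniformly_smooth X.
Proof.
  intros AT UC eps Heps. apply NNPP. intros Hno.
  assert (H1 : forall t0, t0 > 0 -> exists t (x y : X), 0 < t < t0 /\
    vnorm x = 1 /\ vnorm y = 1 /\
    2 + eps * t <= vnorm (vadd x (vscal t y)) + vnorm (vsub X x (vscal t y))).
  { intros t0 Ht0. apply NNPP. intros Hn. apply Hno. exists t0. split; [easy|].
    intros t r Ht [_ Hlub].
    apply Rle_lt_trans with (eps / 2); [|lra].
    apply (Rmult_le_reg_r t); [lra|]. unfold Rdiv at 1.
    rewrite Rmult_assoc, Rinv_l, Rmult_1_r by lra.
    apply Hlub. intros s (x & y & Hx & Hy & ->).
    apply Rnot_lt_le. intros L. apply Hn. exists t, x, y.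
    repeat split; try easy; lra. }
  (* Moving the base point costs [2 * c * t] out of [eps * t] and leaves at least as much; [c <= 1]
     serves the base point zero. *)
  set (c := Rmin (eps / 4) 1).
  assert (Hc : 0 < c <= 1) by (split; [apply Rmin_glb_lt; lra|apply Rmin_r]).
  assert (Hce : c <= eps / 4) by apply Rmin_l.
  assert (H2 : forall (x : X) s, 0 < s -> vnorm x = 1 -> exists y : X, vnorm y = 1 /\
    2 + 2 * c * s <= vnorm (vadd x (vscal s y)) + vnorm (vsub X x (vscal s y))).
  { intros x s Hs Hx. destruct (H1 s Hs) as (t & x' & y & Ht & Hx' & Hy & H).
    destruct (proj2 (AT x' Hx' x) Hx (c * t)) as (a & (T & HT & ->) & HxT).
    { apply Rmult_lt_0_compat; lra. }
    pose proof HT as (Ha & Hsc & Hn & _).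
    exists (T y). split; [now rewrite Hn|].
    assert (G : 2 + 2 * c * t
      <= vnorm (vadd x (vscal t (T y))) + vnorm (vsub X x (vscal t (T y)))).
    { assert (E1 : vnorm (vadd x' (vscal t y))
                   = vnorm (vadd (T x') (vscal t (T y))))
        by now rewrite <- (Hn (vadd _ _)), Ha, Hsc.
      assert (E2 : vnorm (vsub X x' (vscal t y))
                   = vnorm (vsub X (T x') (vscal t (T y))))
        by now rewrite <- (Hn (vsub _ _ _)), isom_sub, Hsc.
      pose proof (vnorm_le_sub (vadd x (vscal t (T y))) (vsub X x (T x'))
        (vadd (T x') (vscal t (T y))) ltac:(vec)).
      pose proof (vnorm_le_sub (vsub X x (vscal t (T y))) (vsub X x (T x'))
        (vsub X (T x') (vscal t (T y))) ltac:(vec)).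
      assert (c * t <= eps / 4 * t) by (apply Rmult_le_compat_r; lra).
      lra. }
    pose proof (symmetric_growth_mono x (T y) t s Hx ltac:(lra)) as M.
    apply (Rmult_le_reg_l t); [lra|].
    apply (Rmult_le_compat_l s) in G; lra. }
  assert (H3 : forall x : X, exists y : X, vnorm y = 1 /\
    2 * vnorm x + 2 * c <= vnorm (vadd x y) + vnorm (vsub X x y)).
  { intros x. destruct (vnorm_ge0 x) as [Hx|Hx].
    - assert (Hi : 0 < / vnorm x) by now apply Rinv_0_lt_compat.
      assert (Hix : vnorm x * / vnorm x = 1) by (apply Rinv_r; lra).
      (* Roughness of the normalized point at scale [/ vnorm x] becomes a unit step at [x]. *)
      destruct (H2 (vscal (/ vnorm x) x) (/ vnorm x) Hi) as (y & Hy & H);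
        [now apply vnorm_normalize|].
      exists y. split; [easy|].
      rewrite <- vscal_addr in H.
      replace (vsub _ _ _) with (vscal (/ vnorm x) (vsub X x y)) in H by vec.
      rewrite !vnorm_scal_pos in H by lra.
      apply (Rmult_le_compat_l (vnorm x)) in H; [|lra].
      rewrite !Rmult_plus_distr_l, <- !(Rmult_assoc (vnorm x) (/ vnorm x)) in H.
      replace (vnorm x * (2 * c * / vnorm x)) with (2 * c * (vnorm x * / vnorm x))
        in H by ring.
      rewrite Hix in H. lra.
    - destruct (H1 1) as (t & _ & y & _ & _ & Hy & _); [lra|].
      exists y. split; [easy|]. apply eq_sym, vnorm_eq0 in Hx. subst.
      rewrite vadd_0. replace (vsub _ _ _) with (vopp y) by vec.
      rewrite vnorm_opp, vnorm_zero. lra. }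
  destruct (choice _ H3) as [step Hstep].
  destruct (uniformly_convex_midpoint X (c / 2) UC) as (kappa & Hk & HM); [lra|].
  apply (rough_walk_contradiction step c (proj1 Hc)) with (kappa := kappa); auto;
    apply Hstep.
Qed.

(** * Slices *)

(** For a single functional, points violating the conclusion in ever thinner slices would form a
    sequence that must converge weakly to [x]. Finitely many functionals are handled by taking
    minima. *)
Lemma w_exposed_slice {X : Banach} (x : X) f fs eps :
  (forall u : nat -> X, (forall n, ball X (u n)) ->
     Un_cv (fun n => f (u n)) 1 -> weak_cv X u x) ->
  dual_sphere X f -> eps > 0 -> Forall (dual_elt X) fs ->
  exists delta, delta > 0 /\ forall y, ball X y -> f y > 1 - delta ->
    Forall (fun g => Rabs (g y - g x) < eps) fs.
Proof.
  intros Hexp Hf Heps. induction 1 as [|g fs Hg Hfs (d1 & Hd1 & IH)].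
  - exists 1. split; [lra|constructor].
  - assert (exists d2, d2 > 0 /\ forall y, ball X y -> f y > 1 - d2 ->
      Rabs (g y - g x) < eps) as (d2 & Hd2 & H2).
    { apply NNPP. intros Hno.
      assert (Hpos : forall n, / INR (S n) > 0)
        by (intros; apply Rinv_0_lt_compat, lt_0_INR; lia).
      destruct (choice (fun n y => ball X y /\ f y > 1 - / INR (S n) /\
        eps <= Rabs (g y - g x))) as [u Hu].
      { intros n. apply NNPP. intros H. apply Hno. exists (/ INR (S n)).
        split; [auto|]. intros y Hy Hfy. apply Rnot_le_lt. intros L.
        apply H. now exists y. }
      assert (Hcv : Un_cv (fun n => f (u n)) 1).
      { intros e He. destruct (archimed_cor1 e He) as (N & HN & HN0).
        exists N. intros n Hn. destruct (Hu n) as (Hb & Hfu & _).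
        pose proof (dual_le_norm f (u n) Hf). unfold ball in Hb.
        assert (/ INR (S n) <= / INR N).
        { apply Rinv_le_contravar; [now apply lt_0_INR|]. apply le_INR. lia. }
        unfold R_dist. apply Rabs_def1; lra. }
      destruct (Hexp u (fun n => proj1 (Hu n)) Hcv g Hg eps Heps) as [N HN].
      destruct (Hu N) as (_ & _ & H). specialize (HN N (le_n N)).
      unfold R_dist in HN. lra. }
    exists (Rmin d1 d2). split; [now apply Rmin_glb_lt|].
    intros y Hy Hfy. pose proof (Rmin_l d1 d2). pose proof (Rmin_r d1 d2).
    constructor; [apply H2|apply IH]; auto; lra.
Qed.

(** When the sum has norm almost 2, an isometry sends it where [f] is almost maximal, so the images
    of both points, once normalized, lie in the slice. *)
Lemma nonsquare_of_slice (X : Banach) f delta d :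
  convex_transitive X -> dual_sphere X f -> delta > 0 -> d < 2 ->
  (forall x y, sphere X x -> sphere X y -> f x > 1 - delta -> f y > 1 - delta ->
     vnorm (vsub X x y) <= d) ->
  nonsquare X.
Proof.
  intros CT Hf Hdelta Hd Hslice.
  (* Both images satisfy f > 1 - 3 eta, so normalizing moves each by at most 3 eta; the choice
     ensures 3 eta < delta and d + 6 eta <= 2 - eta. *)
  set (eta := Rmin (Rmin (delta / 4) ((2 - d) / 8)) (1 / 8)).
  assert (He : 0 < eta).
  { apply Rmin_glb_lt; [apply Rmin_glb_lt|]; lra. }
  assert (He1 : eta <= 1 / 8) by apply Rmin_r.
  assert (He2 : eta <= Rmin (delta / 4) ((2 - d) / 8)) by apply Rmin_l.
  pose proof (Rmin_l (delta / 4) ((2 - d) / 8)).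
  pose proof (Rmin_r (delta / 4) ((2 - d) / 8)).
  exists eta. split; [lra|]. intros x y Hx Hy.
  destruct (Rle_dec (vnorm (vadd x y)) (2 - eta)) as [L|L]; [now left|right].
  set (m := vadd x y) in *.
  assert (Hm0 : 0 < vnorm m) by lra.
  destruct (ct_orbit_norming f (vscal (/ vnorm m) m) eta CT Hf) as (T & HT & HfT);
    [now apply vnorm_normalize|easy|].
  pose proof Hf as [Hd' _]. pose proof Hd' as (Hfa & Hfs & _).
  pose proof HT as (Ha & Hs & Hn & _).
  rewrite Hs, Hfs in HfT. unfold m in HfT at 2. rewrite Ha, Hfa in HfT.
  pose proof (dual_le_norm f (T x) Hf) as Bx. rewrite Hn in Bx.
  pose proof (dual_le_norm f (T y) Hf) as By. rewrite Hn in By.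
  unfold ball in Hx, Hy.
  assert (HS : (1 - eta) * vnorm m < f (T x) + f (T y)).
  { apply (Rmult_lt_compat_l (vnorm m)) in HfT; [|easy].
    rewrite <- Rmult_assoc, Rinv_r, Rmult_1_l in HfT by lra. lra. }
  assert (HS2 : 2 - 3 * eta < f (T x) + f (T y)) by nra.
  assert (N : forall z, vnorm z <= 1 -> 1 - 3 * eta < f (T z) ->
    sphere X (vscal (/ vnorm z) (T z)) /\
    f (vscal (/ vnorm z) (T z)) > 1 - delta /\
    vnorm (vsub X (vscal (/ vnorm z) (T z)) (T z)) <= 3 * eta).
  { intros z Hz Hfz. pose proof (dual_le_norm f (T z) Hf) as Bz. rewrite Hn in Bz.
    assert (Hz0 : 0 < vnorm z) by lra.
    assert (Hi : 0 < / vnorm z) by now apply Rinv_0_lt_compat.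
    assert (Hii : / vnorm z * vnorm z = 1) by (apply Rinv_l; lra).
    assert (Hi1 : 1 <= / vnorm z) by nra.
    split; [|split].
    - unfold sphere. rewrite vnorm_scal_pos, Hn; lra.
    - rewrite Hfs. nra.
    - replace (vsub _ _ _) with (vscal (/ vnorm z - 1) (T z)) by vec.
      rewrite vnorm_scal_pos, Hn by lra.
      rewrite Rmult_minus_distr_r, Hii. lra. }
  destruct (N x Hx) as (Sx & Fx & Dx); [lra|].
  destruct (N y Hy) as (Sy & Fy & Dy); [lra|].
  pose proof (Hslice _ _ Sx Sy Fx Fy) as HD.
  rewrite <- (Hn (vsub X x y)), isom_sub by easy.
  set (a := vscal (/ vnorm x) (T x)) in *. set (b := vscal (/ vnorm y) (T y)) in *.
  pose proof (vnorm_le_add (vsub X a b) (vsub X b (T y)) (vsub X a (T y))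
    ltac:(vec)).
  pose proof (vnorm_le_sub (vsub X a (T y)) (vsub X a (T x)) (vsub X (T x) (T y))
    ltac:(vec)).
  lra.
Qed.

(** Isometries send both points where [f] is almost 1. The midpoint of the images then has norm
    almost 1, so uniform convexity makes the images close, and an inverse isometry brings the second
    point back. *)
Lemma almost_transitive_of_convex (X : Banach) f :
  convex_transitive X -> dual_sphere X f -> uniformly_convex X ->
  almost_transitive X.
Proof.
  intros CT Hf UC x Hx y. split.
  - intros Hy. unfold sphere in *. apply cond_eq. intros e He.
    destruct (Hy e He) as (a & (T & HT & ->) & H).
    assert (HTx : vnorm (T x) = 1) by now rewrite (proj1 (proj2 (proj2 HT))).
    pose proof (vnorm_le_add (vsub X y (T x)) (T x) y ltac:(vec)).
    pose proof (vnorm_le_sub y (vsub X y (T x)) (T x) ltac:(vec)).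
    apply Rabs_def1; lra.
  - intros Hy e He.
    destruct (UC (Rmin e 2)) as (delta & Hd & HUC).
    { split; [apply Rmin_glb_lt; lra|apply Rmin_r]. }
    destruct (ct_orbit_norming f x delta CT Hf Hx Hd) as (T & HT & HfT).
    destruct (ct_orbit_norming f y delta CT Hf Hy Hd) as (T' & HT' & HfT').
    destruct (isom_inverse T' HT') as (T'' & HT'' & Hinv).
    exists (T'' (T x)). split.
    { exists (fun z => T'' (T z)). split; [now apply isom_comp|easy]. }
    rewrite <- (proj1 (proj2 (proj2 HT')) (vsub _ _ _)), isom_sub, Hinv by easy.
    apply Rlt_le_trans with (Rmin e 2); [|apply Rmin_l].
    apply Rnot_le_lt. intros L. apply Rle_ge in L.
    assert (B : forall S (z : X), isom_aut X S -> sphere X z -> ball X (S z)).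
    { intros S z HS Hz. unfold ball, sphere in *.
      rewrite (proj1 (proj2 (proj2 HS))). lra. }
    specialize (HUC _ _ (B _ _ HT' Hy) (B _ _ HT Hx) L).
    pose proof (dual_le_norm f (vscal (1/2) (vadd (T' y) (T x))) Hf) as H.
    rewrite dual_half in H by apply Hf. lra.
Qed.

Theorem theorem2 (X : Banach) :
  convex_transitive X ->
  weakly_dense_in_S X (w_exposed X) ->
  (exists (U : X -> Prop) (d : R),
      rel_weak_open_S X U /\ (exists x, U x) /\ diam_is X U d /\ d < 2) ->
  in_J X.
Proof.
  intros CT Hdense (U & d & HU & HUne & [Hdiam _] & Hd).
  (* An exposed point in [U] has a slice whose trace on the sphere lies in [U], hence has diameter
     at most [d]. *)
  destruct (Hdense U HU HUne) as (x & Hx & _ & f & Hf & _ & Hexp).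
  destruct (proj2 HU x Hx) as (fs & eps & Hfs & Heps & HUx).
  destruct (w_exposed_slice x f fs eps Hexp Hf Heps Hfs) as (delta & Hdelta & Hsl).
  assert (UC : uniformly_convex X).
  { apply nonsquare_uniformly_convex; [easy|].
    apply (nonsquare_of_slice X f delta d); auto.
    intros y z Hy Hz Hfy Hfz. apply Hdiam. exists y, z.
    split; [|split; [|easy]]; apply HUx; auto; apply Hsl; auto;
      unfold ball, sphere in *; lra. }
  assert (AT : almost_transitive X) by now apply (almost_transitive_of_convex X f).
  split; [easy|split; [easy|]]. now apply uniformly_smooth_of_convex.
Qed.
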